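(* Let $\lambda\in(0,\infty)$, let $\alpha$ be a random variable with values in $(0,1)$, and let $(X^{(1)}_k)_{k\in\mathbb Z_+}$ be a copy of the associated randomized INAR(1) process with Poisson innovations (defined in the context). Put $S^{(1)}_k:=X^{(1)}_k-\mathbb E(X^{(1)}_k)$. If $\mathbb E\bigl(\frac{1}{1-\alpha}\bigr)<\infty$, then, in the sense of weak convergence of finite dimensional distributions, $$\Biggl(n^{-1}\sum_{k=1}^{\lfloor nt\rfloor}S^{(1)}_k\Biggr)_{t\in[0,\infty)}=\Biggl(n^{-1}\sum_{k=1}^{\lfloor nt\rfloor}(X^{(1)}_k-\mathbb E(X^{(1)}_k))\Biggr)_{t\in[0,\infty)}\longrightarrow\biggl(\biggl(\frac{\lambda}{1-\alpha}-\mathbb E\biggl(\frac{\lambda}{1-\alpha}\biggr)\biggr)t\biggr)_{t\in[0,\infty)}$$ as $n\to\infty$.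
   Context: Randomized INAR(1) process: let $\lambda\in(0,\infty)$ and let $\alpha$ be a random variable with values in $(0,1)$. Let $X_0$, $\xi_{k,j}$, $\varepsilon_k$ ($k,j\in\mathbb N=\{1,2,\dots\}$) be random variables which are conditionally independent given $\alpha$ and such that, conditionally on $\alpha$, each $\xi_{k,j}$ is Bernoulli with $\mathbb P(\xi_{k,j}=1\mid\alpha)=\alpha=1-\mathbb P(\xi_{k,j}=0\mid\alpha)$, each $\varepsilon_k$ is Poisson with parameter $\lambda$, and $X_0$ is Poisson with parameter $\lambda/(1-\alpha)$. Define $X_k=\sum_{j=1}^{X_{k-1}}\xi_{k,j}+\varepsilon_k$, $k\in\mathbb N$ (with $\sum_{j=1}^0:=0$). $(X^{(1)}_k)_{k\in\mathbb Z_+}$ is a copy of $(X_k)_{k\in\mathbb Z_+}$, where $\mathbb Z_+=\{0,1,2,\dots\}$; $\mathbb E(X^{(1)}_k)=\mathbb E\bigl(\frac{\lambda}{1-\alpha}\bigr)$. *)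

(* Defs.v *)
From HB Require Import structures.
From mathcomp Require Import all_boot all_order all_algebra.
From mathcomp Require Import all_classical all_reals all_analysis.

Set Implicit Arguments.
Unset Strict Implicit.
Unset Printing Implicit Defensive.

Import Order.TTheory GRing.Theory Num.Theory.
Import numFieldNormedType.Exports.

Local Open Scope classical_set_scope.
Local Open Scope ring_scope.

(* [q] is a version of the conditional probability P(A | Z): it is integrable,
   sigma(Z)-measurable, and has the same integral as the indicator of [A] over
   every event {Z in C} of sigma(Z). *)
Definition is_cond_prob {d d'} {T : measurableType d} {T' : measurableType d'}
    {R : realType} (P : probability T R) (Z : T -> T') (A : set T)
    (q : T -> R) : Prop :=
  [/\ P.-integrable setT (EFin \o q),
      (forall B : set R, measurable B ->
         preimage_set_system setT Z measurable (q @^-1` B)) &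
      (forall C : set T', measurable C ->
         (\int[P]_(w in Z @^-1` C) (q w)%:E)%E = P (A `&` Z @^-1` C))].

(* Versions of a conditional probability are almost surely equal, so it does
   not matter which versions [q a] of P(Y_i(a) in B_a | Z) are multiplied. *)
Definition cond_independent {d d' d''} {T : measurableType d}
    {T' : measurableType d'} {T'' : measurableType d''} {R : realType}
    (P : probability T R) (Z : T -> T') (I : Type) (Y : I -> T -> T'') : Prop :=
  forall (m : nat) (i : 'I_m -> I), injective i ->
  forall (B : 'I_m -> set T''), (forall a, measurable (B a)) ->
  forall (q : 'I_m -> T -> R),
    (forall a, is_cond_prob P Z (Y (i a) @^-1` B a) (q a)) ->
    is_cond_prob P Z (\bigcap_(a in [set: 'I_m]) (Y (i a) @^-1` B a))
      (fun w => \prod_(a < m) q a w).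

Inductive inar_index : Type :=
| InarInit
| InarThin of nat & nat
| InarInnov of nat.

(* Only [xi k j] and [eps k] with k, j >= 1 enter the process; the successors
   below leave the index 0 out of the independence requirement. *)
Definition inar_family {T : Type} (X0 : T -> nat) (xi : nat -> nat -> T -> nat)
    (eps : nat -> T -> nat) (i : inar_index) : T -> nat :=
  match i with
  | InarInit => X0
  | InarThin k j => xi k.+1 j.+1
  | InarInnov k => eps k.+1
  end.

Fixpoint inar1 {T : Type} (X0 : T -> nat) (xi : nat -> nat -> T -> nat)
    (eps : nat -> T -> nat) (k : nat) (w : T) : nat :=
  match k with
  | 0%N => X0 w
  | k'.+1 => (\sum_(1 <= j < (inar1 X0 xi eps k' w).+1) xi k'.+1 j w
              + eps k'.+1 w)%N
  end.

(* Equality of all finite-dimensional laws; every subset of nat^m is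
   measurable. *)
Definition same_fdd {d1 d2} {T1 : measurableType d1} {T2 : measurableType d2}
    {R : realType} (P1 : probability T1 R) (X1 : nat -> T1 -> nat)
    (P2 : probability T2 R) (X2 : nat -> T2 -> nat) : Prop :=
  forall (m : nat) (k : 'I_m -> nat) (B : set ('I_m -> nat)),
    P1 [set w | B (fun a => X1 (k a) w)] = P2 [set w | B (fun a => X2 (k a) w)].

Definition cvg_in_law {d1 d2} {T1 : measurableType d1} {T2 : measurableType d2}
    {R : realType} (P1 : probability T1 R) (P2 : probability T2 R) (m : nat)
    (V : nat -> T1 -> 'rV[R]_m) (W : T2 -> 'rV[R]_m) : Prop :=
  forall f : 'rV[R]_m -> R,
    continuous f -> [bounded f x | x in [set: 'rV[R]_m]] ->
    'E_P1[f \o V n]%E @[n --> \oo] --> 'E_P2[f \o W]%E.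

Definition cvg_fdd {d1 d2} {T1 : measurableType d1} {T2 : measurableType d2}
    {R : realType} (P1 : probability T1 R) (P2 : probability T2 R)
    (Y : nat -> R -> T1 -> R) (Z : R -> T2 -> R) : Prop :=
  forall (m : nat) (t : 'I_m -> R), (forall a, 0 <= t a) ->
    cvg_in_law P1 P2 (fun n w => \row_a Y n (t a) w) (fun w => \row_a Z (t a) w).

(* [fine] forgets the extended-real wrapper; it would send an infinite mean
   to 0. *)
Definition centered {d} {T : measurableType d} {R : realType}
    (P : probability T R) (X : nat -> T -> nat) (k : nat) (w : T) : R :=
  (X k w)%:R - fine 'E_P[fun w' => (X k w')%:R%R]%E.

(* Main.v *)
Require Import Defs.
From HB Require Import structures.
From mathcomp Require Import all_boot all_order all_algebra.
From mathcomp Require Import all_classical all_reals all_analysis.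
From mathcomp Require Import ring lra measurable_realfun.

Set Implicit Arguments.
Unset Strict Implicit.
Unset Printing Implicit Defensive.

Import Order.TTheory GRing.Theory Num.Theory.
Import numFieldNormedType.Exports.

Local Open Scope classical_set_scope.
Local Open Scope ring_scope.

(** Given alpha, write X_k for the process and M_N for the partial sums of the
    innovations X_k - alpha X_(k-1) - lambda, 1 <= k <= N.  Summing telescopes:
      (1 - alpha) (X_1 + ... + X_N) = M_N + N lambda - alpha (X_N - X_0),
    so the average of X_1, ..., X_N tends to lambda / (1 - alpha) as soon as
    M_N / N and X_N / N vanish.  This happens almost surely, which is more than
    is asked; with dominated convergence applied to a bounded continuous
    function of finitely many scaled sums, the theorem follows.

    Conditionally on alpha, M_N is a martingale whose increments have variance
    alpha (1 - alpha) X_(k-1) + lambda.  Second moments are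
    weighted by (1 - alpha)^2, because X_k need not be square integrable; then
    E[(1 - alpha)^2 M_N^2] <= 2 lambda N (martingale_variance), while
    E[X_N] = E[lambda / (1 - alpha)] is finite and constant.  Along the squares
    N = n^2 both bounds are summable after scaling, which gives convergence
    along the squares (inar_squares_cvg).  As the X_k are nonnegative, the
    partial sums are monotone and the gaps between squares are filled by
    comparison (cvg_mean_of_squares, inar_strong_law).

    The conditional structure enters through a single rule
    (cond_independent_weight): if W >= 0 does not involve the variable Y_i, then
    E[W 1{Y_i = v}] = E[W p_i(v)], where p_i(v) is the conditional law of Y_i
    given alpha.  The product formula defining conditional independence is this
    rule for W the indicator of a cylinder; Dynkin's theorem and monotone
    approximation extend it to all W.  Removing the variables xi(k, j), eps(k)
    one at a time gives the conditional first and second moments of X_k given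
    the past (one_step_moments).

    Finally the copy of the process is reached by coding a finite-dimensional
    trajectory as a single natural number, so that expectations become series
    determined by the finite-dimensional laws (same_fdd_integral). *)

(** * Integrals determined by a pi-system *)

Lemma adde_cancel {R : numDomainType} (c x y : \bar R) :
  c \is a fin_num -> (x + c = y + c)%E -> x = y.
Proof. by move=> cfin xy; rewrite -(addeK x cfin) xy addeK. Qed.

Section generated_sigma_algebra.
Context {d : measure_display} {T : measurableType d} {R : realType}.
Variables (P : probability T R) (G : set (set T)).
Hypotheses (Gm : G `<=` measurable).

Lemma measurable_fun_g_sigma_sub {d'} {T' : measurableType d'} (f : T -> T') :
  measurable_fun [set: g_sigma_algebraType G] f -> measurable_fun [set: T] f.
Proof.
move=> mf mT B mB; apply: (smallest_sub (@sigma_algebra_measurable _ T) Gm).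
exact: mf.
Qed.

Variables (q1 q2 : T -> R).
Hypotheses (GI : setI_closed G) (GT : G setT).
Hypotheses (mq1 : measurable_fun setT q1) (mq2 : measurable_fun setT q2).
Hypotheses (q1_ge0 : forall w, 0 <= q1 w) (q2_ge0 : forall w, 0 <= q2 w).
Hypothesis q1_fin : (\int[P]_w (q1 w)%:E < +oo)%E.
Hypothesis q12 : forall F, G F ->
  (\int[P]_(w in F) (q1 w)%:E = \int[P]_(w in F) (q2 w)%:E)%E.

(** The sets on which both integrals agree form a Dynkin system; finiteness of
    the total integral is what allows subtraction for complements. *)
Lemma g_sigma_integral_unique F : <<s G >> F ->
  (\int[P]_(w in F) (q1 w)%:E = \int[P]_(w in F) (q2 w)%:E)%E.
Proof.
have mEq1 D : measurable_fun D (EFin \o q1).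
  by apply/measurable_EFinP; exact: measurable_funTS.
have mEq2 D : measurable_fun D (EFin \o q2).
  by apply/measurable_EFinP; exact: measurable_funTS.
suff : <<s G >> `<=` [set A | measurable A /\
    (\int[P]_(w in A) (q1 w)%:E = \int[P]_(w in A) (q2 w)%:E)%E].
  by move=> H /H[].
apply: lambda_system_subset => //; last by move=> A GA; split; [exact: Gm|exact: q12].
apply/dynkin_lambda_system; split.
- by split => //; exact: q12.
- move=> B [mB e12]; split; first exact: measurableC.
  have split_int (q : T -> R) : measurable_fun setT q -> (forall w, 0 <= q w) ->
      (\int[P]_w (q w)%:E
       = \int[P]_(w in B) (q w)%:E + \int[P]_(w in ~` B) (q w)%:E)%E.
    move=> mq q0; rewrite -ge0_integral_setU//.
    + by rewrite setUv.
    + exact: measurableC.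
    + by apply/measurable_EFinP; exact: measurable_funTS.
    + by move=> w _; rewrite lee_fin.
    + exact/disj_setPCl.
  have := q12 GT; rewrite split_int// (split_int q2)// e12.
  rewrite ![(\int[P]_(_ in B) _ + _)%E]addeC.
  apply: adde_cancel; rewrite ge0_fin_numE; last first.
    by apply: integral_ge0 => w _; rewrite lee_fin.
  rewrite -e12 (le_lt_trans _ q1_fin)//; apply: ge0_subset_integral => //.
  by move=> w _; rewrite lee_fin.
- move=> A tA HA; split; first by apply: bigcup_measurable => k _; have [] := HA k.
  rewrite !ge0_integral_bigcup//.
  + by apply: eq_eseriesr => k _; have [] := HA k.
  + by move=> k; have [] := HA k.
  + by move=> w _; rewrite lee_fin.
  + by move=> k; have [] := HA k.
  + by move=> w _; rewrite lee_fin.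
Qed.

Import HBNNSimple.

(** Sums of indicators increasing to [W] are built inside the generated
    sigma-algebra, so that the previous lemma applies to each of them. *)
Lemma g_sigma_integral_weight (W : T -> R) :
  measurable_fun [set: g_sigma_algebraType G] W -> (forall w, 0 <= W w) ->
  (\int[P]_w (W w * q1 w)%:E = \int[P]_w (W w * q2 w)%:E)%E.
Proof.
move=> mW W0.
have mEW : measurable_fun [set: g_sigma_algebraType G] (EFin \o W).
  exact/measurable_EFinP.
pose f := nnsfun_approx measurableT mEW.
have W_lim w : EFin \o f^~ w @ \oo --> (W w)%:E.
  by apply: (cvg_nnsfun_approx measurableT mEW) => // t _; rewrite lee_fin.
have mf n : measurable_fun [set: T] (f n).
  by apply: measurable_fun_g_sigma_sub; exact: measurable_funP.
have f0 n w : 0 <= f n w by apply: fun_ge0.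
have ndf w : nondecreasing_seq (f^~ w).
  by move=> m n mn; exact/lefP/nd_nnsfun_approx.
have mono (q : T -> R) : measurable_fun setT q -> (forall w, 0 <= q w) ->
    (\int[P]_w (W w * q w)%:E = limn (fun n => \int[P]_w (f n w * q w)%:E))%E.
  move=> mq q0; rewrite -monotone_convergence//.
  - apply: eq_integral => w _; apply/esym/cvg_lim => //.
    under eq_fun do rewrite EFinM; rewrite EFinM.
    by apply: cvgeZr => //; exact: W_lim.
  - by move=> n; apply/measurable_EFinP; exact: measurable_funM.
  - by move=> n w _; rewrite lee_fin mulr_ge0.
  - by move=> w _ m n mn; rewrite lee_fin ler_wpM2r// ndf.
rewrite !mono//; congr (limn _); apply/funext => n.
have fin (q : T -> R) : measurable_fun setT q -> (forall w, 0 <= q w) ->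
    (\int[P]_w (f n w * q w)%:E = \sum_(y \in range (f n))
       y%:E * \int[P]_(w in f n @^-1` [set y]) (q w)%:E)%E.
  move=> mq q0.
  have mfy y : measurable (f n @^-1` [set y] : set T).
    by rewrite -[X in measurable X]setTI; exact: mf.
  transitivity (\int[P]_w (\sum_(y \in range (f n))
      (y * \1_(f n @^-1` [set y]) w * q w)%:E))%E.
    apply: eq_integral => w _; rewrite fimfunE.
    by rewrite EFinM -fsumEFin// ge0_mule_fsuml// => y;
       rewrite EFinM nnfun_muleindic_ge0.
  rewrite ge0_integral_fsum//; last 2 first.
  - move=> y; apply/measurable_EFinP; apply: measurable_funM => //.
    exact: measurable_funM.
  - move=> y w _; rewrite EFinM mule_ge0 ?lee_fin//.
    by rewrite -lee_fin EFinM nnfun_muleindic_ge0.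
  apply: eq_fsbigr => y; rewrite inE => -[w0 _ <-].
  rewrite [in RHS]integral_mkcond -ge0_integralZl//; first last.
  - by rewrite lee_fin.
  - by move=> w _; apply: erestrict_ge0 => ? _; rewrite lee_fin.
  - apply/(measurable_restrictT _ _).1 => //.
    by apply/measurable_EFinP; exact: measurable_funTS.
  apply: eq_integral => w _; rewrite -mulrA EFinM; congr (_ * _)%E.
  by rewrite /patch indicE; case: ifPn => _; rewrite ?mul1r ?mul0r.
rewrite !fin//; apply: eq_fsbigr => y _; congr (_ * _)%E.
apply: g_sigma_integral_unique.
by have := measurable_funPTI (f n) (measurable_set1 y).
Qed.

End generated_sigma_algebra.

(** * Decomposition along a variable with natural values *)

Lemma eqn_natr_indicE {T : Type} {R : realType} (N : T -> nat) v w :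
  (N w == v)%:R = \1_(N @^-1` [set v]) w :> R.
Proof.
by rewrite indicE; congr (nat_of_bool _)%:R; apply/eqP/idP; rewrite inE.
Qed.

Lemma measurable_eqn_natr {d} {T : measurableType d} {R : realType}
    (N : T -> nat) v : measurable_fun setT N ->
  measurable_fun [set: T] (fun w => (N w == v)%:R : R).
Proof.
move=> mN; under eq_fun do rewrite eqn_natr_indicE.
by apply: measurable_indic; rewrite -[X in measurable X]setTI; exact: mN.
Qed.

Lemma measurable_natr {d} {T : measurableType d} {R : realType} (N : T -> nat)
    (h : nat -> R) : measurable_fun setT N -> measurable_fun setT (h \o N).
Proof. by move=> mN; apply: measurableT_comp => // _ B _. Qed.

Lemma nneseries_eqn {R : realType} (c : R) n : 0 <= c ->
  (\sum_(v <oo) (c * (n == v)%:R)%:E = c%:E)%E.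
Proof.
move=> c0; rewrite (@nneseriesD1 _ _ n xpredT)//; last first.
  by move=> v _; rewrite lee_fin mulr_ge0.
rewrite eqxx mulr1 eseries0 ?adde0// => v _ /=.
by rewrite eq_sym => /negbTE ->; rewrite mulr0.
Qed.

Section integral_by_value.
Context {d : measure_display} {T : measurableType d} {R : realType}.
Variable (P : probability T R).

Lemma integral_by_value (N : T -> nat) (F : T -> R) :
  measurable_fun setT N -> measurable_fun setT F -> (forall w, 0 <= F w) ->
  (\int[P]_w (F w)%:E = \sum_(v <oo) \int[P]_w (F w * (N w == v)%:R)%:E)%E.
Proof.
move=> mN mF F0; rewrite -integral_nneseries//.
- by apply: eq_integral => w _; rewrite nneseries_eqn.
- move=> v; apply/measurable_EFinP; apply: measurable_funM => //.
  exact: measurable_eqn_natr.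
- by move=> v w _; rewrite lee_fin mulr_ge0.
Qed.

End integral_by_value.

(** * Conditional independence given a random variable *)

Section conditional_independence.
Context {d : measure_display} {T : measurableType d} {R : realType}.
Variables (P : probability T R) (Z : {RV P >-> R}).

(** Needed for the values other than 0 and 1 of a Bernoulli variable. *)
Lemma is_cond_prob0 (A : set T) : measurable A -> P A = 0%E ->
  is_cond_prob P Z A (fun=> 0).
Proof.
move=> mA A0; split.
- exact: integrable0.
- move=> B mB; have [B0|nB0] := pselect (B 0).
    by exists setT; [exact: measurableT|rewrite setTI; apply/seteqP; split => w].
  by exists set0; [exact: measurable0|rewrite setTI; apply/seteqP; split => w].
- move=> C mC; rewrite integral0; apply/esym/eqP; rewrite eq_le measure_ge0 andbT.
  have mZC : measurable (Z @^-1` C) by have := measurable_funPTI Z mC.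
  by rewrite -A0 le_measure ?inE//; exact: measurableI.
Qed.

Let sigmaZ := preimage_set_system setT Z measurable.

Lemma sigmaZ_sub : sigmaZ `<=` measurable.
Proof. by move=> _ [B mB <-]; rewrite setTI; exact: (measurable_funPTI Z mB). Qed.

Lemma sigmaZ_setI : setI_closed sigmaZ.
Proof.
move=> _ _ [B mB <-] [C mC <-]; exists (B `&` C); first exact: measurableI.
by rewrite !setTI preimage_setI.
Qed.

Lemma sigmaZ_setT : sigmaZ setT.
Proof. by exists setT; [exact: measurableT|rewrite setTI preimage_setT]. Qed.

(** A conditional probability given [Z] may serve as a weight in integrals over
    the events of sigma(Z). *)
Lemma cond_prob_measurable_sigmaZ (A : set T) (q : T -> R) :
  is_cond_prob P Z A q -> measurable_fun [set: g_sigma_algebraType sigmaZ] q.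
Proof.
by move=> [_ mq _] _ B mB; rewrite setTI; apply: sub_sigma_algebra; exact: mq.
Qed.

Lemma cond_prob_measurable (A : set T) (q : T -> R) :
  is_cond_prob P Z A q -> measurable_fun [set: T] q.
Proof.
by move/cond_prob_measurable_sigmaZ; apply: measurable_fun_g_sigma_sub;
  exact: sigmaZ_sub.
Qed.

Variables (J : choiceType) (Y : J -> T -> nat) (p : J -> nat -> T -> R).
Hypotheses (mY : forall i, measurable_fun [set: T] (Y i))
  (indepY : cond_independent P Z Y)
  (p_law : forall i v, is_cond_prob P Z (Y i @^-1` [set v]) (p i v))
  (p_ge0 : forall i v w, 0 <= p i v w).

(** A list may constrain an index twice, possibly in contradictory ways: this
    makes cylinders stable under intersection by concatenation of lists. *)
Definition cylinder (s : seq (J * nat)) : set T :=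
  [set w | all (fun x => Y x.1 w == x.2) s].

Lemma measurable_cylinder s : measurable (cylinder s).
Proof.
elim: s => [|x s IH].
  by rewrite (_ : cylinder _ = setT)//; apply/seteqP.
rewrite (_ : cylinder _ = (Y x.1 @^-1` [set x.2]) `&` cylinder s).
  by apply: measurableI => //; rewrite -[X in measurable X]setTI; exact: mY.
apply/seteqP; split => w /=; first by move=> /andP[/eqP].
by move=> [e ?]; apply/andP; split => //; apply/eqP.
Qed.

Lemma cylinder_law s : uniq (map fst s) ->
  is_cond_prob P Z (cylinder s) (fun w => \prod_(x <- s) p x.1 x.2 w).
Proof.
move=> us.
have /indepY : injective (fun a : 'I_(size s) => (tnth (in_tuple s) a).1).
  move=> a b ab; apply/val_inj/eqP => /=.
  have sm (c : 'I_(size s)) : (c < size (map fst s))%N by rewrite size_map.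
  have := tnth_nth (tnth (in_tuple s) a) (in_tuple s).
  move: ab; move: {2}(tnth (in_tuple s) a) => x0 ab tE.
  rewrite -(nth_uniq x0.1 (sm a) (sm b) us) !(nth_map x0)//.
  by move/eqP: ab; rewrite !tE.
move=> /(_ (fun a => [set (tnth (in_tuple s) a).2])) /(_ (fun=> I)).
move=> /(_ (fun a => p (tnth (in_tuple s) a).1 (tnth (in_tuple s) a).2)).
move=> /(_ (fun a => p_law _ _)).
rewrite (_ : \bigcap_(a in _) _ = cylinder s); last first.
  apply/seteqP; split => w /=.
    by move=> H; apply/allP => x /seq_tnthP[a ->]; apply/eqP/(H a).
  by move=> /allP H a _ /=; apply/eqP/H/mem_tnth.
congr (is_cond_prob _ _ _ _); apply/funext => w.
by rewrite (big_tnth _ _ s).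
Qed.

(** A pi-system generating sigma(Z, Y_j for j <> i). *)
Definition cylinders_off (i : J) : set (set T) :=
  [set A | exists C s, [/\ measurable C, i \notin map fst s
                         & A = (Z @^-1` C) `&` cylinder s]].

Lemma cylinders_off_sub i : cylinders_off i `<=` measurable.
Proof.
move=> _ [C [s [mC _ ->]]]; apply: measurableI; last exact: measurable_cylinder.
exact: (measurable_funPTI Z mC).
Qed.

Lemma cylinders_off_setI i : setI_closed (cylinders_off i).
Proof.
move=> _ _ [C [s [mC si ->]]] [C' [s' [mC' si' ->]]].
exists (C `&` C'), (s ++ s'); split.
- exact: measurableI.
- by rewrite map_cat mem_cat negb_or si.
- rewrite preimage_setI setIACA; congr (_ `&` _).
  by rewrite /cylinder; apply/seteqP; split => w /=; rewrite all_cat;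
    [move=> H; apply/andP|move=> /andP].
Qed.

Lemma cylinders_off_setT i : cylinders_off i setT.
Proof.
exists setT, [::]; split => //.
by rewrite preimage_setT setTI; apply/seteqP.
Qed.

Definition measurable_off (i : J) {d'} {T' : measurableType d'} (f : T -> T') :=
  measurable_fun [set: g_sigma_algebraType (cylinders_off i)] f.

Lemma measurable_off_measurable i {d'} {T' : measurableType d'} (f : T -> T') :
  measurable_off i f -> measurable_fun [set: T] f.
Proof. by apply: measurable_fun_g_sigma_sub; exact: cylinders_off_sub. Qed.

Lemma measurable_off_Z i : measurable_off i Z.
Proof.
move=> _ C mC; rewrite setTI; apply: sub_sigma_algebra.
by exists C, [::]; split => //; apply/seteqP; split => // w [].
Qed.

Lemma measurable_off_Y i j : j != i -> measurable_off i (Y j).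
Proof.
move=> ji _ B _; rewrite setTI.
rewrite (_ : Y j @^-1` B = \bigcup_(v in B) cylinder [:: (j, v)]).
  apply: bigcup_measurable => v _; apply: sub_sigma_algebra.
  exists setT, [:: (j, v)]; split; first exact: measurableT.
    by rewrite /= inE eq_sym.
  by rewrite preimage_setT setTI.
apply/seteqP; split => w /=; first by move=> Bw; exists (Y j w) => //; rewrite /cylinder /= eqxx.
by move=> [v Bv]; rewrite /cylinder /= andbT => /eqP ->.
Qed.

(** For an empty cylinder both sides vanish.  Otherwise its constraints can be
    taken on distinct indices, and the product formula with and without the
    constraint Y_i = v differ by the factor p_i(v), which can be moved inside
    the event as it is a function of [Z]. *)
Lemma cylinders_off_law i v F : cylinders_off i F ->
  (\int[P]_(w in F) ((Y i w == v)%:R)%:E = \int[P]_(w in F) (p i v w)%:E)%E.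
Proof.
move=> [C [s [mC si ->]]].
have mZC : measurable (Z @^-1` C) by exact: (measurable_funPTI Z mC).
(* repeated identical constraints are harmless; contradictory ones are not *)
pose s' := undup s.
have ss' : cylinder s = cylinder s'.
  by apply/seteqP; split => w /allP H; apply/allP => x xs; apply: H;
    move: xs; rewrite mem_undup.
have [us'|nus'] := boolP (uniq (map fst s')); last first.
  rewrite (_ : cylinder s = set0) ?setI0 ?integral_set0//.
  rewrite ss'; apply/seteqP; split => w //= /allP H; move: nus' => /negP; apply.
  rewrite map_inj_in_uniq ?undup_uniq// => -[a b] [a' b'] /H /= /eqP <- /H /= /eqP <-.
  by move=> ->.
have us : uniq (map fst ((i, v) :: s')).
  rewrite /= us' andbT; apply: contra si => /mapP[x xs ->].
  by apply: map_f; rewrite -mem_undup.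
have [_ _ /(_ C mC)] := cylinder_law us.
have cE : cylinder ((i, v) :: s') `&` Z @^-1` C
    = (Y i @^-1` [set v]) `&` (Z @^-1` C `&` cylinder s).
  rewrite ss'; rewrite /cylinder; apply/seteqP; split => w /=.
    by move=> [/andP[/eqP -> ->] ?].
  by move=> [-> [? ->]]; rewrite eqxx.
rewrite cE.
have mYv : measurable (Y i @^-1` [set v]).
  by rewrite -[X in measurable X]setTI; exact: mY.
rewrite -integral_indic//; last first.
  by apply: measurableI => //; exact: measurable_cylinder.
move=> H.
transitivity (\int[P]_(x in Z @^-1` C `&` cylinder s)
    (\1_(Y i @^-1` [set v]) x)%:E)%E.
  by apply: eq_integral => w _; rewrite -eqn_natr_indicE.
rewrite -{}H.
have ls' := cylinder_law us'.
have mp : measurable_fun setT (p i v) by apply: cond_prob_measurable (p_law i v).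
pose W w : R := \1_(Z @^-1` C) w * p i v w.
have mW : measurable_fun [set: g_sigma_algebraType sigmaZ] W.
  apply: measurable_funM; last exact: cond_prob_measurable_sigmaZ (p_law i v).
  apply: measurable_indic; apply: sub_sigma_algebra; exists C => //.
  by rewrite setTI.
have W0 w : 0 <= W w by rewrite mulr_ge0.
rewrite [LHS]integral_mkcond [RHS]integral_mkcond.
transitivity (\int[P]_w (W w * \prod_(x <- s') p x.1 x.2 w)%:E)%E.
  apply: eq_integral => w _; rewrite /patch /W indicE big_cons /=.
  by case: ifPn => _; rewrite ?mul1r ?mul0r.
transitivity (\int[P]_w (W w * \1_(cylinder s') w)%:E)%E; last first.
  apply: eq_integral => w _; rewrite /patch /W !indicE ss' in_setI /=.
  by case: (_ \in _); case: (_ \in _); rewrite ?(mul1r, mul0r, mulr1, mulr0).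
apply: (g_sigma_integral_weight sigmaZ_sub) => //.
- exact: sigmaZ_setI.
- exact: sigmaZ_setT.
- exact: cond_prob_measurable ls'.
- by apply: measurable_indic; exact: measurable_cylinder.
- by move=> w; apply: prodr_ge0.
- have [+ _ _] := ls' => /integrable_lty; exact.
- move=> _ [B mB <-]; rewrite setTI; have [_ _ ->//] := ls'.
  rewrite integral_indic//; last exact: measurable_cylinder.
  exact: (measurable_funPTI Z mB).
Qed.

(** The working form of conditional independence: a variable is replaced by
    its conditional law in front of any weight that does not involve it. *)
Lemma cond_independent_weight i v (W : T -> R) :
  measurable_off i W -> (forall w, 0 <= W w) ->
  (\int[P]_w (W w * (Y i w == v)%:R)%:E = \int[P]_w (W w * p i v w)%:E)%E.
Proof.
move=> mW W0; apply: (g_sigma_integral_weight (@cylinders_off_sub i)) => //.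
- exact: cylinders_off_setI.
- exact: cylinders_off_setT.
- exact: measurable_eqn_natr.
- exact: cond_prob_measurable (p_law i v).
- rewrite cylinders_off_law; last exact: cylinders_off_setT.
  by have [+ _ _] := p_law i v => /integrable_lty; exact.
- by move=> F; exact: cylinders_off_law.
Qed.

End conditional_independence.

Section conditional_expectation.
Context {d : measure_display} {T : measurableType d} {R : realType}.
Variables (P : probability T R) (Z : {RV P >-> R}).
Variables (J : choiceType) (Y : J -> T -> nat) (p : J -> nat -> T -> R).
Hypotheses (mY : forall i, measurable_fun [set: T] (Y i))
  (indepY : cond_independent P Z Y)
  (p_law : forall i v, is_cond_prob P Z (Y i @^-1` [set v]) (p i v))
  (p_ge0 : forall i v w, 0 <= p i v w).

(** The same rule for a function [h] of the variable; [g] is the conditional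
    expectation of [h (Y i)] given [Z]. *)
Lemma cond_expectation_weight i (h : nat -> R) (g : T -> R) (W : T -> R) :
  measurable_off Z Y i W -> (forall w, 0 <= W w) -> (forall v, 0 <= h v) ->
  (forall w, \sum_(v <oo) (h v * p i v w)%:E = (g w)%:E)%E ->
  (\int[P]_w (W w * h (Y i w))%:E = \int[P]_w (W w * g w)%:E)%E.
Proof.
move=> mW W0 h0 hg.
have mWT := measurable_off_measurable mY mW.
rewrite (integral_by_value P (mY i))//; first last.
- by move=> w; rewrite mulr_ge0.
- by apply: measurable_funM => //; exact: measurable_natr.
transitivity (\sum_(v <oo) \int[P]_w (W w * (h v * p i v w))%:E)%E.
  apply: eq_eseriesr => v _.
  transitivity (\int[P]_w ((h v)%:E * (W w * p i v w)%:E))%E; last first.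
    by apply: eq_integral => w _; rewrite -EFinM mulrCA.
  have mpv : measurable_fun [set: T] (p i v) by exact: cond_prob_measurable (p_law i v).
  rewrite ge0_integralZl//; first last.
  - by rewrite lee_fin.
  - by move=> w _; rewrite lee_fin mulr_ge0.
  - by apply/measurable_EFinP; exact: measurable_funM.
  rewrite -(cond_independent_weight mY indepY p_law p_ge0)//.
  rewrite -ge0_integralZl//; first last.
  - by rewrite lee_fin.
  - by move=> w _; rewrite lee_fin mulr_ge0.
  - apply/measurable_EFinP; apply: measurable_funM => //.
    exact: measurable_eqn_natr.
  apply: eq_integral => w _; rewrite -EFinM.
  by have [<-|_] := eqVneq (Y i w) v; rewrite ?mulr1 ?mulr0// mulrC.
rewrite -integral_nneseries//; first last.
- by move=> v w _; rewrite lee_fin !mulr_ge0.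
- move=> v; apply/measurable_EFinP; apply: measurable_funM => //.
  by apply: measurable_funM => //; exact: cond_prob_measurable (p_law i v).
apply: eq_integral => w _; rewrite EFinM -hg -nneseriesZl; last first.
  by move=> v _; rewrite lee_fin mulr_ge0.
by apply: eq_eseriesr => v _; rewrite -EFinM.
Qed.

End conditional_expectation.

(** * Moments of the Poisson law *)

Section poisson_moments.
Context {R : realType}.
Variable r : R.
Hypothesis r_gt0 : 0 < r.

Lemma poisson_pmf_sum1 : (\sum_(v <oo) (poisson_pmf r v)%:E = 1)%E.
Proof.
have : poisson_prob r 0 setT = 1%E by exact: probability_setT.
rewrite /poisson_prob r_gt0 -nneseries_esumT// => v.
by rewrite lee_fin poisson_pmf_ge0.
Qed.

Lemma poisson_pmfS v : v.+1%:R * poisson_pmf r v.+1 = r * poisson_pmf r v.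
Proof.
rewrite /poisson_pmf r_gt0 factS natrM exprS.
have v0 : v.+1%:R != 0 :> R by rewrite pnatr_eq0.
have f0 : v`!%:R != 0 :> R by rewrite pnatr_eq0 -lt0n fact_gt0.
by field; rewrite f0 nat1r v0.
Qed.

(** Size biasing shifts a Poisson variable by one, which yields all moments from
    the total mass. *)
Lemma poisson_size_bias (h : nat -> R) : (forall v, 0 <= h v) ->
  (\sum_(v <oo) (v%:R * h v * poisson_pmf r v)%:E
   = r%:E * \sum_(v <oo) (h v.+1 * poisson_pmf r v)%:E)%E.
Proof.
move=> h0; rewrite nneseries_recl//; last first.
  by move=> v _; rewrite lee_fin !mulr_ge0// poisson_pmf_ge0.
rewrite !mul0r add0e -(@nneseries_addn _ _ 1); last first.
  by move=> v; rewrite lee_fin !mulr_ge0// poisson_pmf_ge0.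
rewrite -nneseriesZl; last first.
  by move=> v _; rewrite lee_fin mulr_ge0// poisson_pmf_ge0.
apply: eq_eseriesr => v _; rewrite -EFinM addn1; congr EFin.
by rewrite mulrAC poisson_pmfS mulrAC mulrA.
Qed.

Lemma poisson_moment1 : (\sum_(v <oo) (v%:R * poisson_pmf r v)%:E = r%:E)%E.
Proof.
have := @poisson_size_bias (fun=> 1) (fun=> ler01).
under eq_eseriesr do rewrite mulr1.
move=> ->; under eq_eseriesr do rewrite mul1r.
by rewrite poisson_pmf_sum1 mule1.
Qed.

Lemma poisson_moment2 :
  (\sum_(v <oo) (v%:R ^+ 2 * poisson_pmf r v)%:E = (r ^+ 2 + r)%:E)%E.
Proof.
under eq_eseriesr do rewrite expr2.
rewrite poisson_size_bias//.
under eq_eseriesr do rewrite -natr1 mulrDl mul1r EFinD.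
rewrite nneseriesD; first last.
- by move=> v _ _; rewrite lee_fin poisson_pmf_ge0.
- by move=> v _ _; rewrite lee_fin mulr_ge0// poisson_pmf_ge0.
by rewrite poisson_moment1 poisson_pmf_sum1 -EFinD -EFinM mulrDr mulr1 expr2.
Qed.

End poisson_moments.

(** * Summable integrals and averages along squares *)

Lemma nneseries_summable_cvg0 {R : realType} (f : nat -> R) :
  (forall k, 0 <= f k) -> (\sum_(k <oo) (f k)%:E)%E \is a fin_num ->
  f n @[n --> \oo] --> (0 : R).
Proof.
move=> f0 sfin; apply: cvg_series_cvg_0.
apply: nondecreasing_is_cvgn.
  by apply/nondecreasing_seqP => n; rewrite /series /= big_nat_recr//= lerDl.
exists (fine (\sum_(k <oo) (f k)%:E)%E) => _ [n _ <-].
rewrite -lee_fin fineK// /series /= -sumEFin.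
by apply: nneseries_lim_ge => k _ _; rewrite lee_fin.
Qed.

(** The sum of the series is integrable, hence finite almost everywhere. *)
Lemma ae_cvg0_of_summable_integral {d} {T : measurableType d} {R : realType}
    (P : probability T R) (f : nat -> T -> R) :
  (forall k, measurable_fun [set: T] (f k)) -> (forall k w, 0 <= f k w) ->
  (\sum_(k <oo) \int[P]_w (f k w)%:E < +oo)%E ->
  {ae P, forall w, f n w @[n --> \oo] --> (0 : R)}.
Proof.
move=> mf f0 sf.
have mEf k : measurable_fun [set: T] (EFin \o f k) by exact/measurable_EFinP.
have intS : P.-integrable [set: T] (fun w => \sum_(k <oo) (f k w)%:E)%E.
  apply/integrableP; split.
    apply: ge0_emeasurable_sum => k; last by move=> _; exact: mEf.
    by move=> w _ _; rewrite lee_fin.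
  under eq_integral.
    move=> w _; rewrite gee0_abs; last first.
      by apply: nneseries_ge0 => k _ _; rewrite lee_fin.
    over.
  by rewrite integral_nneseries//; move=> k w _; rewrite lee_fin.
have := integrable_ae measurableT intS.
apply: filterS => w /(_ I) sfin.
exact: nneseries_summable_cvg0.
Qed.

Lemma sum_inv_square_lt_pinfty {R : realType} (C : R) : 0 <= C ->
  (\sum_(k <oo) (C / (k.+1 ^ 2)%:R)%:E < +oo)%E.
Proof.
move=> C0; apply: (@le_lt_trans _ _ (2 * C)%:E); last exact: ltry.
apply: lime_le.
  apply: is_cvg_nneseries => k _ _; rewrite lee_fin.
  by apply: divr_ge0 => //; exact: ler0n.
apply: nearW => n; rewrite sumEFin lee_fin.
(* compare with the telescoping series of 2C (1/(k+1) - 1/(k+2)) *)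
apply: (@le_trans _ _ (2 * C * (1 - n.+1%:R^-1))); last first.
  by rewrite ler_piMr ?mulr_ge0// gerBl invr_ge0.
elim: n => [|n IH]; first by rewrite big_geq// invr1 subrr mulr0.
rewrite big_nat_recr//=; apply: le_trans (lerD IH (lexx _)) _.
rewrite natrX -(natr1 n.+1); set x : R := n.+1%:R.
have x1 : 1 <= x by rewrite ler1n.
have x0 : 0 < x by exact: lt_le_trans x1.
have xx : 0 < x + 1 by rewrite addr_gt0.
rewrite -subr_ge0.
have -> : 2 * C * (1 - (x + 1)^-1) - (2 * C * (1 - x^-1) + C / x ^+ 2)
    = C * (x - 1) / (x ^+ 2 * (x + 1)).
  by field; rewrite !gt_eqF.
by rewrite divr_ge0 ?mulr_ge0 ?subr_ge0 ?exprn_ge0// ltW.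
Qed.

Lemma cvg0_of_sqr {R : realType} (x : nat -> R) :
  x n ^+ 2 @[n --> \oo] --> (0 : R) -> x n @[n --> \oo] --> (0 : R).
Proof.
move=> /cvgrPdist_lt x2; apply/cvgrPdist_lt => e e0.
near=> n; rewrite sub0r normrN -(ltr_pXn2r (n := 2))// ?nnegrE ?(ltW e0)//.
have : `|0 - x n ^+ 2| < e ^+ 2 by near: n; apply: x2; rewrite exprn_gt0.
by rewrite sub0r normrN normrX.
Unshelve. all: by end_near. Qed.

Lemma nat_sqrt_bounds (n : nat) : exists k, (k ^ 2 <= n < k.+1 ^ 2)%N.
Proof.
elim: n => [|n [k /andP[kn nk]]]; first by exists 0%N.
have [e|ne] := eqVneq n.+1 (k.+1 ^ 2)%N.
  by exists k.+1; rewrite e leqnn/= ltn_exp2r.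
by exists k; rewrite (leq_trans kn)//= ltn_neqAle ne.
Qed.

(** For [(k+1)^2 <= n < (k+2)^2], monotonicity encloses [u n / n] between values
    on squares, up to the factor [((k+2)/(k+1))^2] that tends to 1. *)
Lemma cvg_mean_of_squares {R : realType} (u : nat -> R) (l : R) :
  (forall n, 0 <= u n) -> (forall m n, (m <= n)%N -> u m <= u n) ->
  u (k.+1 ^ 2)%N / (k.+1 ^ 2)%:R @[k --> \oo] --> l ->
  u n / n%:R @[n --> \oo] --> l.
Proof.
move=> u0 ndu; set v := fun k => u (k.+1 ^ 2)%N / (k.+1 ^ 2)%:R => vl.
pose r k : R := (k.+2%:R / k.+1%:R) ^+ 2.
have r1 : r k @[k --> \oo] --> (1 : R).
  have -> : r = fun k => (1 + harmonic k) * (1 + harmonic k).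
    apply/funext => k; rewrite /r /harmonic /= -expr2; congr (_ ^+ 2).
    by rewrite -natr1 mulrDl divff// mul1r.
  have h : 1 + @harmonic R k @[k --> \oo] --> (1 : R).
    rewrite -[X in _ --> X]addr0.
    by apply: cvgD; [exact: cvg_cst|exact: cvg_harmonic].
  by rewrite -[X in _ --> X]mulr1; exact: cvgM.
have upper : v k.+1 * r k @[k --> \oo] --> l.
  rewrite -[X in _ --> X]mulr1; apply: cvgM => //.
  by move: vl; rewrite -cvg_shiftS.
have lower : v k / r k @[k --> \oo] --> l.
  rewrite -[X in _ --> X]mulr1 -[X in _ * X]invr1; apply: cvgM => //.
  by apply: cvgV => //; exact: oner_neq0.
apply/cvgrPdist_lt => e e0.
move/cvgrPdist_lt : upper => /(_ e e0)[K1 _ up].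
move/cvgrPdist_lt : lower => /(_ e e0)[K2 _ lo].
near=> n.
have [k /andP[kn nk]] := nat_sqrt_bounds n.
have Kk : ((maxn K1 K2).+1 <= k)%N.
  rewrite -ltnS -(@ltn_exp2r _ _ 2)// (leq_ltn_trans _ nk)//.
  by near: n; exists ((maxn K1 K2).+1 ^ 2)%N.
case: k Kk kn nk => // j; rewrite ltnS geq_max => /andP[K1j K2j] jn nj.
have j0 : 0 < (j.+1 ^ 2)%:R :> R by rewrite ltr0n expn_gt0.
have jj0 : 0 < (j.+2 ^ 2)%:R :> R by rewrite ltr0n expn_gt0.
have n0 : 0 < n%:R :> R by rewrite (lt_le_trans j0)// ler_nat.
have up_n : u n / n%:R <= v j.+1 * r j.
  rewrite (_ : v _ * _ = u (j.+2 ^ 2)%N / (j.+1 ^ 2)%:R); last first.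
    by rewrite /v /r expr_div_n -!natrX mulrA divfK// gt_eqF.
  by rewrite ler_pM ?invr_ge0 ?ler0n// ?ndu ?(ltnW nj)// lef_pV2// ler_nat.
have lo_n : v j / r j <= u n / n%:R.
  rewrite (_ : _ / r j = u (j.+1 ^ 2)%N / (j.+2 ^ 2)%:R); last first.
    by rewrite /v /r expr_div_n -!natrX invf_div mulrA divfK// gt_eqF.
  rewrite ler_pM ?invr_ge0 ?ler0n// ?ndu// lef_pV2// ler_nat.
  exact: ltnW.
have := up j K1j; have := lo j K2j; rewrite /= !ltr_distl.
by move=> /andP[_ lo1] /andP[up1 _]; rewrite /=; lra.
Unshelve. all: by end_near. Qed.

Lemma truncn_bounds {R : realType} (x : R) : 0 <= x ->
  (Num.truncn x)%:R <= x /\ x - 1 < (Num.truncn x)%:R.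
Proof. by move=> x0; rewrite truncn_le// ltrBlDr natr1 truncnS_gt. Qed.

(** [u N / n = (u N / N) (N / n)] with [N / n --> t]; the hypothesis on [u 0]
    covers [t = 0], for which [N] does not grow. *)
Lemma cvg_truncn_mean {R : realType} (u : nat -> R) (l t : R) : 0 <= t ->
  u 0%N = 0 -> u n / n%:R @[n --> \oo] --> l ->
  u (Num.truncn (n%:R * t)) / n%:R @[n --> \oo] --> l * t.
Proof.
move=> t0 u00 ul.
have [->|tn0] := eqVneq t 0.
  rewrite mulr0; under eq_fun do rewrite mulr0 truncn0 u00 mul0r.
  exact: cvg_cst.
have {tn0}t_gt0 : 0 < t by rewrite lt_def tn0.
pose N (n : nat) := Num.truncn (n%:R * t).
have nt0 n : 0 <= n%:R * t by rewrite mulr_ge0.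
have N_dvg : N n @[n --> \oo] --> \oo.
  apply/cvgnyPge => M; near=> n.
  rewrite truncn_ge_nat// -ler_pdivrMr//.
  by near: n; exact: nbhs_infty_ger.
have ratio : (N n)%:R / n%:R @[n --> \oo] --> t.
  apply/cvgrPdist_lt => e e0; near=> n.
  have n0 : 0 < n%:R :> R by near: n; exact: nbhs_infty_gtr.
  have [b1 b2] := truncn_bounds (nt0 n).
  have ne : n%:R^-1 < e.
    by rewrite invf_plt ?posrE//; near: n; exact: nbhs_infty_gtr.
  have h1 : (N n)%:R / n%:R <= t by rewrite ler_pdivrMr// mulrC.
  have h2 : t - n%:R^-1 <= (N n)%:R / n%:R.
    by rewrite ler_pdivlMr// mulrBl mulVf ?gt_eqF// mulrC ltW.
  by rewrite ger0_norm ?subr_ge0//; lra.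
have uN : u (N n) / (N n)%:R @[n --> \oo] --> l by exact: cvg_comp N_dvg ul.
apply: cvg_trans (cvgM uN ratio); apply: near_eq_cvg; near=> n => /=.
have : (0 < N n)%N by near: n; move/cvgnyPge : N_dvg => /(_ 1%N).
by rewrite -(ltr0n R) => Nn0; rewrite mulrA divfK// gt_eqF.
Unshelve. all: by end_near. Qed.

(** * Expectations determined by finite-dimensional laws *)

Lemma integral_on_value {d} {T : measurableType d} {R : realType}
    (P : probability T R) (N : T -> nat) (g : nat -> R) x :
  measurable_fun [set: T] N -> 0 <= g x ->
  (\int[P]_w (g (N w) * (N w == x)%:R)%:E = (g x)%:E * P [set w | N w = x])%E.
Proof.
move=> mN g0.
have mNx : measurable (N @^-1` [set x]).
  by rewrite -[X in measurable X]setTI; exact: mN.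
rewrite (_ : [set w | N w = x] = N @^-1` [set x])//.
rewrite -[X in P X]setIT -integral_indic// -ge0_integralZl//; last first.
  by apply/measurable_EFinP; apply: measurable_indic.
apply: eq_integral => w _; rewrite -EFinM -eqn_natr_indicE; congr EFin.
by have [<-|_] := eqVneq (N w) x; rewrite ?mulr0.
Qed.

Section same_law.
Context {d1 d2 : measure_display} {T1 : measurableType d1} {T2 : measurableType d2}
  {R : realType}.
Variables (P1 : probability T1 R) (P2 : probability T2 R).

(** Both integrals are the same series over the values of the variables, once
    [h] is split into its positive and negative parts. *)
Lemma same_law_integral (N1 : T1 -> nat) (N2 : T2 -> nat) (h : nat -> R) :
  measurable_fun [set: T1] N1 -> measurable_fun [set: T2] N2 ->
  (forall x, P1 [set w | N1 w = x] = P2 [set w | N2 w = x]) ->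
  (\int[P1]_w (h (N1 w))%:E = \int[P2]_w (h (N2 w))%:E)%E.
Proof.
move=> mN1 mN2 eqN.
have ge0_case (g : nat -> R) : (forall n, 0 <= g n) ->
    (\int[P1]_w (g (N1 w))%:E = \int[P2]_w (g (N2 w))%:E)%E.
  move=> g0.
  rewrite (integral_by_value P1 mN1) ?(integral_by_value P2 mN2)//.
  - by apply: eq_eseriesr => x _; rewrite !integral_on_value// eqN.
  - exact: measurable_natr.
  - exact: measurable_natr.
rewrite integralE [RHS]integralE.
congr (_ - _)%E.
- transitivity (\int[P1]_w (h^\+ (N1 w))%:E)%E.
    by apply: eq_integral => w _; rewrite funeposE /funrpos EFin_max.
  rewrite ge0_case//; apply: eq_integral => w _.
  by rewrite funeposE /funrpos EFin_max.
- transitivity (\int[P1]_w (h^\- (N1 w))%:E)%E.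
    by apply: eq_integral => w _; rewrite funenegE /funrneg EFin_max.
  rewrite ge0_case//; apply: eq_integral => w _.
  by rewrite funenegE /funrneg EFin_max.
Qed.

End same_law.

Section fdd_coding.
Context {d : measure_display} {T : measurableType d}.
Variables (m : nat) (k : 'I_m -> nat) (X : nat -> T -> nat).
Hypothesis mX : forall i, measurable_fun [set: T] (X i).

(** Finitely many natural numbers form a countable type, so a finite trajectory
    is a single nat-valued variable. *)
Definition fdd_code (w : T) : nat := pickle [ffun a => X (k a) w].

Lemma measurable_fdd_code : measurable_fun [set: T] fdd_code.
Proof.
move=> _ B _; rewrite setTI.
rewrite (_ : _ @^-1` B = \bigcup_(n in B)
    if unpickle n is Some f then
      if pickle f == n then
        \bigcap_(a in [set: 'I_m]) (X (k a) @^-1` [set (f : {ffun 'I_m -> nat}) a])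
      else set0
    else set0).
  apply: bigcup_measurable => n _; case: unpickle => [f|]; last exact: measurable0.
  case: ifP => _; last exact: measurable0.
  apply: fin_bigcap_measurable => // a _.
  by rewrite -[X in measurable X]setTI; exact: mX.
apply/seteqP; split => w /=.
  move=> Bw; exists (fdd_code w) => //; rewrite pickleK eqxx => a _ /=.
  by rewrite ffunE.
move=> [n Bn]; case: unpickle => // f; case: eqP => // fn H.
suff -> : fdd_code w = n by [].
rewrite -fn /fdd_code; congr pickle; apply/ffunP => a; rewrite ffunE.
exact: H.
Qed.

Definition fdd_decode {R : realType} (F : ('I_m -> nat) -> R) (n : nat) : R :=
  if unpickle n is Some f then F (fun a => (f : {ffun 'I_m -> nat}) a) else 0.

Lemma fdd_codeK {R : realType} (F : ('I_m -> nat) -> R) w :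
  fdd_decode F (fdd_code w) = F (fun a => X (k a) w).
Proof.
rewrite /fdd_decode pickleK; congr F; apply/funext => a.
by rewrite ffunE.
Qed.

Lemma measurable_fdd_fun {R : realType} (F : ('I_m -> nat) -> R) :
  measurable_fun [set: T] (fun w => F (fun a => X (k a) w)).
Proof.
under eq_fun do rewrite -fdd_codeK.
exact: measurable_natr measurable_fdd_code.
Qed.

End fdd_coding.

Lemma same_fdd_integral {d1 d2} {T1 : measurableType d1} {T2 : measurableType d2}
    {R : realType} (P1 : probability T1 R) (X1 : nat -> T1 -> nat)
    (P2 : probability T2 R) (X2 : nat -> T2 -> nat) m (k : 'I_m -> nat)
    (F : ('I_m -> nat) -> R) :
  (forall i, measurable_fun [set: T1] (X1 i)) ->
  (forall i, measurable_fun [set: T2] (X2 i)) ->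
  same_fdd P1 X1 P2 X2 ->
  (\int[P1]_w (F (fun a => X1 (k a) w))%:E
   = \int[P2]_w (F (fun a => X2 (k a) w))%:E)%E.
Proof.
move=> mX1 mX2 same.
under eq_integral do rewrite -fdd_codeK.
under [RHS]eq_integral do rewrite -fdd_codeK.
apply: same_law_integral; try exact: measurable_fdd_code.
by move=> x; exact: (same m k (fun v => pickle [ffun a => v a] = x)).
Qed.

Lemma cvg_row {R : realType} {U : Type} (F : set_system U) {FF : Filter F} m
    (V : U -> 'rV[R]_m) (v : 'rV[R]_m) :
  (forall a, V u 0 a @[u --> F] --> v 0 a) -> V u @[u --> F] --> v.
Proof.
move=> H; apply/cvg_ballP => e e0.
have /filter_forall H' : forall a, \forall u \near F, ball (v 0 a) e (V u 0 a).
  by move=> a; have /cvg_ballP := H a; exact.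
near=> u; split => // i a; rewrite ord1.
by move: a; near: u.
Unshelve. all: by end_near. Qed.

Section scaled_sums.
Context {R : realType} {m : nat}.
Variables (t : 'I_m -> R) (c : R) (n : nat).

Definition scaled_sums (x : nat -> nat) : 'rV[R]_m :=
  \row_a (n%:R^-1 * \sum_(1 <= k < (Num.truncn (n%:R * t a)).+1) ((x k)%:R - c)).

(** The scaled sums involve only the times up to [horizon]. *)
Let horizon := \max_a Num.truncn (n%:R * t a).

Lemma scaled_sums_horizon (x : nat -> nat) :
  scaled_sums x = scaled_sums (fun k => x (inord k : 'I_horizon.+1)).
Proof.
apply/rowP => a; rewrite !mxE; congr (_ * _).
rewrite big_nat [RHS]big_nat; apply: eq_bigr => k /andP[_ kN].
by rewrite inordK// (leq_trans kN)// ltnS (leq_bigmax a).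
Qed.

Lemma measurable_fun_scaled_sums {d} {T : measurableType d} (X : nat -> T -> nat)
    (f : 'rV[R]_m -> R) :
  (forall i, measurable_fun [set: T] (X i)) ->
  measurable_fun [set: T] (fun w => f (scaled_sums (X^~ w))).
Proof.
move=> mX; under eq_fun do rewrite scaled_sums_horizon.
exact: (measurable_fdd_fun (fun a : 'I_horizon.+1 => a : nat) mX
  (fun v => f (scaled_sums (fun k => v (inord k))))).
Qed.

Lemma same_fdd_scaled_sums {d1 d2} {T1 : measurableType d1} {T2 : measurableType d2}
    (P1 : probability T1 R) (X1 : nat -> T1 -> nat)
    (P2 : probability T2 R) (X2 : nat -> T2 -> nat) (f : 'rV[R]_m -> R) :
  (forall i, measurable_fun [set: T1] (X1 i)) ->
  (forall i, measurable_fun [set: T2] (X2 i)) ->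
  same_fdd P1 X1 P2 X2 ->
  (\int[P1]_w (f (scaled_sums (X1^~ w)))%:E
   = \int[P2]_w (f (scaled_sums (X2^~ w)))%:E)%E.
Proof.
move=> mX1 mX2 same.
under eq_integral do rewrite scaled_sums_horizon.
under [RHS]eq_integral do rewrite scaled_sums_horizon.
exact: (same_fdd_integral (fun a : 'I_horizon.+1 => a : nat)
  (fun v => f (scaled_sums (fun k => v (inord k)))) mX1 mX2 same).
Qed.

End scaled_sums.

Lemma scaled_sums_cvg {R : realType} (m : nat) (t : 'I_m -> R) (c l : R)
    (x : nat -> nat) : (forall a, 0 <= t a) ->
  (\sum_(1 <= k < n.+1) (x k)%:R) / n%:R @[n --> \oo] --> l ->
  scaled_sums t c n x @[n --> \oo] --> \row_a ((l - c) * t a).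
Proof.
move=> t0 xl; apply: cvg_row => a; rewrite mxE.
pose u n : R := \sum_(1 <= k < n.+1) ((x k)%:R - c).
have ul : u n / n%:R @[n --> \oo] --> l - c.
  have h : (\sum_(1 <= k < n.+1) (x k)%:R) / n%:R - c @[n --> \oo] --> l - c.
    by apply: cvgB => //; exact: cvg_cst.
  apply: cvg_trans h; apply: near_eq_cvg; near=> n.
  have n0 : 0 < n%:R :> R by near: n; exact: nbhs_infty_gtr.
  rewrite /u sumrB mulrBl; congr (_ - _).
  by rewrite sumr_const_nat subn1 /= -(mulr_natr c) mulfK// gt_eqF.
have u0 : u 0%N = 0 by rewrite /u big_geq.
have := cvg_truncn_mean (t0 a) u0 ul.
by under eq_fun do rewrite mulrC; under [X in _ -> X @ _ --> _]eq_fun do rewrite mxE.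
Unshelve. all: by end_near. Qed.

Lemma measurable_fun_line {R : realType} {d} {T : measurableType d} m
    (f : 'rV[R]_m -> R) (t : 'I_m -> R) (g : T -> R) :
  continuous f -> measurable_fun [set: T] g ->
  measurable_fun [set: T] (fun w => f (\row_a (g w * t a))).
Proof.
move=> cf mg.
pose h s := f (\row_a (s * t a)).
suff ch : continuous h by exact: (measurableT_comp (continuous_measurable_fun ch) mg).
move=> s; apply: (@continuous_comp _ _ _ (fun s : R => \row_a (s * t a)) f); last exact: cf.
apply: cvg_row => a; rewrite mxE; under eq_fun do rewrite mxE.
by apply: cvgM; [exact: cvg_id|exact: cvg_cst].
Qed.

(** * Means of nonnegative variables and random sums *)

Lemma measurable_natR {d} {T : measurableType d} {R : realType} (N : T -> nat) :
  measurable_fun setT N -> measurable_fun setT (fun w => (N w)%:R : R).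
Proof. exact: measurable_natr. Qed.

Ltac measurability := repeat first
  [ assumption | by [] | exact: measurable_cst
  | apply: measurable_funD | apply: measurable_funM | apply: measurable_funX
  | apply: measurable_natR ].

Ltac nonnegativity := repeat first
  [ by [] | assumption | apply: mulr_ge0 | apply: addr_ge0 | apply: exprn_ge0
  | apply: ler0n ].

Section mean.
Context {d : measure_display} {T : measurableType d} {R : realType}.
Variable P : probability T R.

Definition mean (f : T -> R) : \bar R := \int[P]_w (f w)%:E.

Lemma mean_ge0 f : (forall w, 0 <= f w) -> (0 <= mean f)%E.
Proof. by move=> f0; apply: integral_ge0 => w _; rewrite lee_fin. Qed.

Lemma eq_mean f g : (forall w, f w = g w) -> mean f = mean g.
Proof. by move=> fg; apply: eq_integral => w _; rewrite fg. Qed.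

Lemma meanD (f g : T -> R) : measurable_fun setT f -> measurable_fun setT g ->
  (forall w, 0 <= f w) -> (forall w, 0 <= g w) ->
  mean (fun w => f w + g w) = (mean f + mean g)%E.
Proof.
move=> mf mg f0 g0; rewrite /mean -ge0_integralD//.
- by move=> w _; rewrite lee_fin.
- exact/measurable_EFinP.
- by move=> w _; rewrite lee_fin.
- exact/measurable_EFinP.
Qed.

Lemma meanZ (c : R) (f : T -> R) : 0 <= c -> measurable_fun setT f ->
  (forall w, 0 <= f w) -> mean (fun w => c * f w) = (c%:E * mean f)%E.
Proof.
move=> c0 mf f0; rewrite /mean -ge0_integralZl//.
- exact/measurable_EFinP.
- by move=> w _; rewrite lee_fin.
Qed.

Lemma mean_cst (c : R) : mean (fun=> c) = c%:E.
Proof. by rewrite /mean integral_cst//= probability_setT mule1. Qed.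

Lemma le_mean (f g : T -> R) : measurable_fun setT f -> measurable_fun setT g ->
  (forall w, 0 <= f w) -> (forall w, f w <= g w) -> (mean f <= mean g)%E.
Proof.
move=> mf mg f0 fg; apply: ge0_le_integral => //.
- by move=> w _; rewrite lee_fin.
- exact/measurable_EFinP.
- exact/measurable_EFinP.
- by move=> w _; rewrite lee_fin.
Qed.

(** To compare two means it is enough to do so on each level set of a nat-valued
    variable; there, a sum with that many terms becomes a sum of fixed length. *)
Lemma eq_mean_by_value (N : T -> nat) (f g : T -> R) :
  measurable_fun setT N -> measurable_fun setT f -> measurable_fun setT g ->
  (forall w, 0 <= f w) -> (forall w, 0 <= g w) ->
  (forall n, mean (fun w => (N w == n)%:R * f w)
             = mean (fun w => (N w == n)%:R * g w)) ->
  mean f = mean g.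
Proof.
move=> mN mf mg f0 g0 H.
rewrite /mean (integral_by_value P mN mf f0) (integral_by_value P mN mg g0).
apply: eq_eseriesr => n _; have := H n; rewrite /mean.
by under eq_integral do rewrite mulrC; under [X in _ = X -> _]eq_integral do rewrite mulrC.
Qed.

End mean.
Arguments mean {d T R} P f%_R.

Lemma measurable_sum_nat {d} {T : measurableType d} (f : nat -> T -> nat) n :
  (forall j, (j < n)%N -> measurable_fun [set: T] (f j.+1)) ->
  measurable_fun [set: T] (fun w => \sum_(1 <= j < n.+1) f j w)%N.
Proof.
elim: n => [_|n IH mf].
  by under eq_fun do rewrite big_geq//; exact: measurable_cst.
under eq_fun do rewrite big_nat_recr//=; apply: measurable_fun_addn.
  by apply: IH => j jn; exact/mf/ltnW.
exact: mf.
Qed.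

Lemma measurable_random_sum {d} {T : measurableType d} (N : T -> nat)
    (f : nat -> T -> nat) :
  measurable_fun [set: T] N -> (forall j, measurable_fun [set: T] (f j.+1)) ->
  measurable_fun [set: T] (fun w => \sum_(1 <= j < (N w).+1) f j w)%N.
Proof.
move=> mN mf _ B mB; rewrite setTI.
rewrite (_ : _ @^-1` B = \bigcup_n ((N @^-1` [set n]) `&`
    ((fun w => \sum_(1 <= j < n.+1) f j w)%N @^-1` B))).
  apply: bigcupT_measurable => n; apply: measurableI.
    by rewrite -[X in measurable X]setTI; exact: mN.
  by rewrite -[X in measurable X]setTI; apply: measurable_sum_nat => // j _; exact: mf.
apply/seteqP; split => w /=; first by move=> Bw; exists (N w).
by move=> [n _ [/= ->]].
Qed.

(** * The randomized INAR(1) process: conditional moments *)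

HB.instance Definition _ := gen_eqMixin inar_index.
HB.instance Definition _ := gen_choiceMixin inar_index.

Section randomized_inar.
Context {R : realType} {d : measure_display} {T : measurableType d}.
Variables (P : probability T R) (lambda : R).
Hypothesis lambda_gt0 : 0 < lambda.
Variable alpha : {RV P >-> R}.
Hypothesis alpha01 : forall w, 0 < alpha w < 1.
Variables (X0 : {RV P >-> nat}) (xi : nat -> nat -> {RV P >-> nat})
  (eps : nat -> {RV P >-> nat}).
Hypothesis indep : cond_independent P alpha (inar_family X0 xi eps).
Hypothesis xi_law : forall k j, (1 <= k)%N -> (1 <= j)%N ->
  is_cond_prob P alpha (xi k j @^-1` [set 1%N]) alpha /\
  is_cond_prob P alpha (xi k j @^-1` [set 0%N]) (fun w => 1 - alpha w).
Hypothesis eps_law : forall k, (1 <= k)%N -> forall l : nat,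
  is_cond_prob P alpha (eps k @^-1` [set l]) (fun=> poisson_pmf lambda l).
Hypothesis X0_law : forall l : nat,
  is_cond_prob P alpha (X0 @^-1` [set l])
    (fun w => poisson_pmf (lambda / (1 - alpha w)) l).

Local Notation Y := (inar_family X0 xi eps).
Local Notation X := (inar1 X0 xi eps).
Local Notation E f := (mean P f%R).

Lemma alpha_gt0 w : 0 < alpha w. Proof. by have /andP[] := alpha01 w. Qed.
Lemma alpha_ge0 w : 0 <= alpha w. Proof. exact/ltW/alpha_gt0. Qed.
Lemma subr_alpha_gt0 w : 0 < 1 - alpha w.
Proof. by rewrite subr_gt0; have /andP[] := alpha01 w. Qed.
Lemma subr_alpha_ge0 w : 0 <= 1 - alpha w. Proof. exact/ltW/subr_alpha_gt0. Qed.
Let lambda_ge0 : 0 <= lambda. Proof. exact: ltW. Qed.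

Definition inar_pmf (i : inar_index) (v : nat) (w : T) : R :=
  match i with
  | InarInit => poisson_pmf (lambda / (1 - alpha w)) v
  | InarThin _ _ => if v == 0%N then 1 - alpha w
                    else alpha w * (1%N == v)%:R
  | InarInnov _ => poisson_pmf lambda v
  end.

Lemma inar_pmf_ge0 i v w : 0 <= inar_pmf i v w.
Proof.
case: i => [|k j|k] /=; try exact: poisson_pmf_ge0.
by case: ifP => _; rewrite ?subr_alpha_ge0// mulr_ge0 ?alpha_ge0.
Qed.

Lemma measurable_inar_family i : measurable_fun [set: T] (Y i).
Proof. by case: i => [|k j|k] /=; exact: measurable_funP. Qed.

(** The conditional probabilities of the values 0 and 1 add up to 1. *)
Lemma thinning_ge2_null k j v : P (xi k.+1 j.+1 @^-1` [set v.+2]) = 0%E.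
Proof.
have [[i1 _ e1] [i0 _ e0]] := @xi_law k.+1 j.+1 isT isT.
have mx B : measurable (xi k.+1 j.+1 @^-1` B) by exact: measurable_funPTI.
have := e1 setT measurableT; have := e0 setT measurableT.
rewrite !preimage_setT !setIT => p0 p1.
have p01 : (P (xi k.+1 j.+1 @^-1` [set 1%N] `|` xi k.+1 j.+1 @^-1` [set 0%N]) = 1)%E.
  rewrite measureU//; last first.
    by apply/seteqP; split => w //= [-> ].
  transitivity (\int[P]_w (alpha w)%:E + \int[P]_w (1 - alpha w)%:E)%E.
    by rewrite p1 p0.
  rewrite -integralD_EFin//.
  under eq_integral do rewrite /= -EFinD addrC subrK.
  by rewrite integral_cst//= probability_setT mule1.
apply/eqP; rewrite eq_le measure_ge0 andbT.
have m01 := measurableU _ _ (mx [set 1%N]) (mx [set 0%N]).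
have := probability_setC P m01; rewrite p01 subee// => <-.
rewrite le_measure ?inE//; first exact: measurableC.
by move=> w /= ->; case.
Qed.

Lemma inar_pmf_law i v : is_cond_prob P alpha (Y i @^-1` [set v]) (inar_pmf i v).
Proof.
case: i => [|k j|k] /=; [exact: X0_law| |exact: eps_law].
have [a1 a0] := @xi_law k.+1 j.+1 isT isT.
case: v => [|[|v]] /=.
- exact: a0.
- move: a1; congr (is_cond_prob _ _ _ _); apply/funext => w.
  by rewrite -[LHS]mulr1.
- rewrite (_ : inar_pmf _ _ = fun=> 0); last first.
    by apply/funext => w; rewrite -[RHS](mulr0 (alpha w)).
  apply: is_cond_prob0; last exact: thinning_ge2_null.
  exact: measurable_funPTI.
Qed.

Local Notation off := (measurable_off alpha Y).

Lemma thinning_weight k j (h : nat -> R) (W : T -> R) : h 0%N = 0 -> (forall v, 0 <= h v) ->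
  off (InarThin k j) W -> (forall w, 0 <= W w) ->
  E (fun w => W w * h (xi k.+1 j.+1 w)) = E (fun w => W w * (h 1%N * alpha w)).
Proof.
move=> h00 h0 mW W0.
apply: (cond_expectation_weight measurable_inar_family indep inar_pmf_law
  inar_pmf_ge0 (i := InarThin k j)) => // w /=.
rewrite -[RHS](nneseries_eqn 1) ?mulr_ge0 ?alpha_ge0//.
apply: eq_eseriesr => v _; congr EFin; rewrite -mulrA.
by case: v => [|[|v]] /=; rewrite ?h00 ?mulr0 ?mul0r ?mulr1.
Qed.

Lemma innovation_weight k (W : T -> R) :
  off (InarInnov k) W -> (forall w, 0 <= W w) ->
  E (fun w => W w * (eps k.+1 w)%:R) = E (fun w => W w * lambda) /\
  E (fun w => W w * (eps k.+1 w)%:R ^+ 2)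
    = E (fun w => W w * (lambda ^+ 2 + lambda)).
Proof.
move=> mW W0; split.
  apply: (cond_expectation_weight measurable_inar_family indep inar_pmf_law
    inar_pmf_ge0 (i := InarInnov k) (h := fun v => v%:R)) => // w.
  exact: (poisson_moment1 lambda_gt0).
apply: (cond_expectation_weight measurable_inar_family indep inar_pmf_law
  inar_pmf_ge0 (i := InarInnov k) (h := fun v => v%:R ^+ 2)) => // w.
exact: (poisson_moment2 lambda_gt0).
Qed.

Lemma init_weight (W : T -> R) :
  off InarInit W -> (forall w, 0 <= W w) ->
  let mu w := lambda / (1 - alpha w) in
  E (fun w => W w * (X0 w)%:R) = E (fun w => W w * mu w) /\
  E (fun w => W w * (X0 w)%:R ^+ 2) = E (fun w => W w * (mu w ^+ 2 + mu w)).
Proof.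
move=> mW W0 mu.
have mu0 w : 0 < mu w by rewrite divr_gt0// subr_alpha_gt0.
split.
  apply: (cond_expectation_weight measurable_inar_family indep inar_pmf_law
    inar_pmf_ge0 (i := InarInit) (h := fun v => v%:R)) => // w.
  exact: (poisson_moment1 (mu0 w)).
apply: (cond_expectation_weight measurable_inar_family indep inar_pmf_law
  inar_pmf_ge0 (i := InarInit) (h := fun v => v%:R ^+ 2)) => // w.
exact: (poisson_moment2 (mu0 w)).
Qed.

(** The first time at which a variable influences the process. *)
Definition time (i : inar_index) : nat :=
  match i with InarInit => 0%N | InarThin k _ => k.+1 | InarInnov k => k.+1 end.

(** Functions of alpha and of the variables acting up to time [k] are the
    intended case; avoiding each single later variable is what
    [cond_independent_weight] asks of a weight. *)
Definition history (k : nat) {d'} {T' : measurableType d'} (f : T -> T') :=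
  forall i, (k < time i)%N -> off i f.

Lemma history_measurable k {d'} {T' : measurableType d'} (f : T -> T') :
  history k f -> measurable_fun [set: T] f.
Proof.
move=> /(_ (InarInnov k) (ltnSn k)); apply: measurable_off_measurable.
exact: measurable_inar_family.
Qed.

Lemma history_le k l {d'} {T' : measurableType d'} (f : T -> T') :
  (k <= l)%N -> history k f -> history l f.
Proof. by move=> kl hf i li; apply: hf; exact: leq_ltn_trans li. Qed.

Lemma history_cst k (c : R) : history k (fun=> c).
Proof. by move=> i _; exact: measurable_cst. Qed.

Lemma history_alpha k : history k alpha.
Proof. by move=> i _; exact: measurable_off_Z. Qed.

Lemma historyD k (f g : T -> R) : history k f -> history k g ->
  history k (fun w => f w + g w).
Proof. by move=> hf hg i ki; apply: measurable_funD; [exact: hf|exact: hg]. Qed.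

Lemma historyM k (f g : T -> R) : history k f -> history k g ->
  history k (fun w => f w * g w).
Proof. by move=> hf hg i ki; apply: measurable_funM; [exact: hf|exact: hg]. Qed.

Lemma history_natr k (N : T -> nat) (h : nat -> R) : history k N ->
  history k (fun w => h (N w)).
Proof. by move=> hN i ki; apply: measurable_natr; exact: hN. Qed.

Lemma off_family i j : j != i -> off i (Y j).
Proof. exact: measurable_off_Y. Qed.

Lemma history_inar k : history k (X k).
Proof.
elim: k => [|k IH] i /= ki.
  by apply: (@off_family i InarInit); apply: contraTneq ki => <-.
apply: measurable_fun_addn.
  apply: measurable_random_sum; first exact: (history_le (leqnSn k) IH).
  move=> j; apply: (@off_family i (InarThin k j)).
  by apply: contraTneq ki => <-; rewrite ltnn.
apply: (@off_family i (InarInnov k)).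
by apply: contraTneq ki => <-; rewrite ltnn.
Qed.

Lemma off_thinning_sum k i r : (forall j, (j < r)%N -> InarThin k j != i) ->
  off i (fun w => \sum_(1 <= j < r.+1) xi k.+1 j w)%N.
Proof.
by move=> H; apply: measurable_sum_nat => j jr; exact: (off_family (H j jr)).
Qed.

Section one_step.
Variable k : nat.
Local Notation S r w := (\sum_(1 <= j < r.+1) xi k.+1 j w)%N.

Lemma measurable_thinning_sum r : measurable_fun [set: T] (fun w => S r w).
Proof. by apply: measurable_sum_nat => j _; exact: measurable_funP. Qed.

(** The mean and second moment of a binomial law, obtained by removing the
    Bernoulli variables one by one: the cross term is a first moment with the
    partial sum put into the weight. *)
Lemma thinning_sum_moments r (W : T -> R) : history k W -> (forall w, 0 <= W w) ->
  E (fun w => W w * (S r w)%:R) = E (fun w => W w * (r%:R * alpha w)) /\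
  E (fun w => W w * (S r w)%:R ^+ 2)
  = E (fun w => W w * (r%:R ^+ 2 * alpha w ^+ 2
                       + r%:R * (alpha w * (1 - alpha w)))).
Proof.
elim: r W => [|r IH] W hW W0.
  by split; apply: eq_mean => w; rewrite big_geq// !(mul0r, expr0n, mulr0, addr0).
have mW := history_measurable hW.
have mS := measurable_thinning_sum r.
have mxi : measurable_fun [set: T] (xi k.+1 r.+1) by exact: measurable_funP.
have ma : measurable_fun [set: T] alpha by exact: measurable_funP.
have a0 := alpha_ge0.
have Wxi := hW (InarThin k r) (ltnSn k).
have Soff : off (InarThin k r) (fun w => S r w).
  apply: off_thinning_sum => j jr; apply/eqP => -[] e.
  by rewrite e ltnn in jr.
have SS w : (S r.+1 w)%:R = (S r w)%:R + (xi k.+1 r.+1 w)%:R :> R.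
  by rewrite big_nat_recr//= natrD.
have [IH1 IH2] := IH W hW W0.
have xi1 := thinning_weight (h := fun v => v%:R) erefl (fun=> ler0n _ _) Wxi W0.
split.
  under eq_mean do rewrite SS mulrDr.
  rewrite meanD; [|measurability|measurability|by move=> w; nonnegativity..].
  rewrite IH1 xi1 -meanD; [|measurability|measurability|by move=> w; nonnegativity..].
  by apply: eq_mean => w; rewrite -natr1; ring.
have xi2 := thinning_weight (h := fun v => v%:R ^+ 2)
  (expr0n _ 2) (fun v => exprn_ge0 2 (ler0n _ v)) Wxi W0.
have hW2 : history k (fun w => W w * (2 * alpha w)).
  by apply: historyM => //; apply: historyM; [exact: history_cst|exact: history_alpha].
have W20 w : 0 <= W w * (2 * alpha w) by nonnegativity.
have [IH3 _] := IH _ hW2 W20.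
have offWS : off (InarThin k r) (fun w => W w * (2 * (S r w)%:R)).
  apply: measurable_funM => //; apply: measurable_funM; first exact: measurable_cst.
  exact: measurable_natR.
have WS0 w : 0 <= W w * (2 * (S r w)%:R) by nonnegativity.
have cross := thinning_weight (h := fun v => v%:R) erefl (fun=> ler0n _ _) offWS WS0.
transitivity (E (fun w => W w * (S r w)%:R ^+ 2
    + (W w * (2 * (S r w)%:R) * (xi k.+1 r.+1 w)%:R
       + W w * (xi k.+1 r.+1 w)%:R ^+ 2))).
  by apply: eq_mean => w; rewrite SS; ring.
rewrite meanD; [|measurability|measurability|by move=> w; nonnegativity..].
rewrite meanD; [|measurability|measurability|by move=> w; nonnegativity..].
rewrite IH2 xi2 cross.
have -> : E (fun w => W w * (2 * (S r w)%:R) * (1%:R * alpha w))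
    = E (fun w => W w * (2 * alpha w) * (S r w)%:R).
  by apply: eq_mean => w; ring.
have b0 := subr_alpha_ge0.
have mb : measurable_fun [set: T] (fun w => 1 - alpha w).
  by apply: measurable_funB.
rewrite IH3 -meanD; [|measurability|measurability|by move=> w; nonnegativity..].
rewrite -meanD; [|measurability|measurability|by move=> w; nonnegativity..].
by apply: eq_mean => w; rewrite -natr1; ring.
Qed.

(** One step of the recursion started from a fixed value [r]. *)
Lemma one_step_moments_on r (W : T -> R) : history k W -> (forall w, 0 <= W w) ->
  E (fun w => W w * (S r w + eps k.+1 w)%:R)
  = E (fun w => W w * (r%:R * alpha w + lambda)) /\
  E (fun w => W w * (S r w + eps k.+1 w)%:R ^+ 2)
  = E (fun w => W w * ((r%:R * alpha w + lambda) ^+ 2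
                       + (r%:R * (alpha w * (1 - alpha w)) + lambda))).
Proof.
move=> hW W0.
have mW := history_measurable hW.
have mS := measurable_thinning_sum r.
have me : measurable_fun [set: T] (eps k.+1) by exact: measurable_funP.
have ma : measurable_fun [set: T] alpha by exact: measurable_funP.
have mb : measurable_fun [set: T] (fun w => 1 - alpha w) by exact: measurable_funB.
have a0 := alpha_ge0.
have b0 := subr_alpha_ge0.
have Weps := hW (InarInnov k) (ltnSn k).
have Soff : off (InarInnov k) (fun w => S r w).
  by apply: off_thinning_sum => j _; apply/eqP.
have [S1 S2] := thinning_sum_moments r hW W0.
have [e1 e2] := innovation_weight Weps W0.
split.
  under eq_mean do rewrite natrD mulrDr.
  rewrite meanD; [|measurability|measurability|by move=> w; nonnegativity..].
  rewrite S1 e1 -meanD; [|measurability|measurability|by move=> w; nonnegativity..].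
  by apply: eq_mean => w; ring.
have hW2 : history k (fun w => W w * (2 * lambda)).
  by apply: historyM => //; exact: history_cst.
have W20 w : 0 <= W w * (2 * lambda) by nonnegativity.
have [S3 _] := thinning_sum_moments r hW2 W20.
have offWS : off (InarInnov k) (fun w => W w * (2 * (S r w)%:R)).
  apply: measurable_funM => //; apply: measurable_funM; first exact: measurable_cst.
  exact: measurable_natR.
have WS0 w : 0 <= W w * (2 * (S r w)%:R) by nonnegativity.
have [cross _] := innovation_weight offWS WS0.
transitivity (E (fun w => W w * (S r w)%:R ^+ 2
    + (W w * (2 * (S r w)%:R) * (eps k.+1 w)%:R
       + W w * (eps k.+1 w)%:R ^+ 2))).
  by apply: eq_mean => w; rewrite natrD; ring.
rewrite meanD; [|measurability|measurability|by move=> w; nonnegativity..].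
rewrite meanD; [|measurability|measurability|by move=> w; nonnegativity..].
rewrite S2 e2 cross.
have -> : E (fun w => W w * (2 * (S r w)%:R) * lambda)
    = E (fun w => W w * (2 * lambda) * (S r w)%:R).
  by apply: eq_mean => w; ring.
rewrite S3 -meanD; [|measurability|measurability|by move=> w; nonnegativity..].
rewrite -meanD; [|measurability|measurability|by move=> w; nonnegativity..].
by apply: eq_mean => w; ring.
Qed.

(** On each event X_k = x the number of thinned individuals is constant. *)
Lemma one_step_moments (W : T -> R) : history k W -> (forall w, 0 <= W w) ->
  E (fun w => W w * (X k.+1 w)%:R)
  = E (fun w => W w * ((X k w)%:R * alpha w + lambda)) /\
  E (fun w => W w * (X k.+1 w)%:R ^+ 2)
  = E (fun w => W w * (((X k w)%:R * alpha w + lambda) ^+ 2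
                       + ((X k w)%:R * (alpha w * (1 - alpha w)) + lambda))).
Proof.
move=> hW W0.
have mW := history_measurable hW.
have mXk := history_measurable (history_inar (k := k)).
have mXk1 := history_measurable (history_inar (k := k.+1)).
have ma : measurable_fun [set: T] alpha by exact: measurable_funP.
have mb : measurable_fun [set: T] (fun w => 1 - alpha w) by exact: measurable_funB.
have a0 := alpha_ge0.
have b0 := subr_alpha_ge0.
have hWx x : history k (fun w => W w * (X k w == x)%:R).
  apply: historyM => //.
  exact: (history_natr (fun n => (n == x)%:R) (@history_inar k)).
have Wx0 x w : 0 <= W w * (X k w == x)%:R by nonnegativity.
have XE w : X k.+1 w = (S (X k w) w + eps k.+1 w)%N by [].
split; apply: (eq_mean_by_value mXk); [measurability|measurability|
  by move=> w; nonnegativity|by move=> w; nonnegativity|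
  |measurability|measurability|by move=> w; nonnegativity|
  by move=> w; nonnegativity|] => x.
- have [H _] := one_step_moments_on x (hWx x) (Wx0 x).
  transitivity (E (fun w => W w * (X k w == x)%:R * (S x w + eps k.+1 w)%:R)).
    apply: eq_mean => w; rewrite XE.
    by have [->|_] := eqVneq (X k w) x; rewrite ?(mul0r, mulr0, mul1r, mulr1).
  rewrite H; apply: eq_mean => w.
  by have [->|_] := eqVneq (X k w) x; rewrite ?(mul0r, mulr0, mul1r, mulr1).
- have [_ H] := one_step_moments_on x (hWx x) (Wx0 x).
  transitivity (E (fun w => W w * (X k w == x)%:R * (S x w + eps k.+1 w)%:R ^+ 2)).
    apply: eq_mean => w; rewrite XE.
    by have [->|_] := eqVneq (X k w) x; rewrite ?(mul0r, mulr0, mul1r, mulr1).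
  rewrite H; apply: eq_mean => w.
  by have [->|_] := eqVneq (X k w) x; rewrite ?(mul0r, mulr0, mul1r, mulr1).
Qed.

End one_step.

(** * The martingale and its variance *)

(** The stationary conditional mean, the fixed point of
    [fun x => x * alpha + lambda]. *)
Let mu w := lambda / (1 - alpha w).

Let mu_fix w : mu w * alpha w + lambda = mu w.
Proof. by rewrite /mu; field; rewrite gt_eqF ?subr_alpha_gt0. Qed.

Let mu_ge0 w : 0 <= mu w.
Proof. by rewrite /mu divr_ge0// subr_alpha_ge0. Qed.

Let malpha : measurable_fun [set: T] alpha.
Proof. exact: measurable_funP. Qed.

Let msubr_alpha : measurable_fun [set: T] (fun w => 1 - alpha w).
Proof. exact: measurable_funB. Qed.

Lemma measurable_inar k : measurable_fun [set: T] (X k).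
Proof. exact: (history_measurable (@history_inar k)). Qed.

Let measurable_inv_subr_alpha : measurable_fun [set: T] (fun w => (1 - alpha w)^-1).
Proof.
rewrite (_ : (fun w => _) = (@powR R ^~ (-1)) \o (fun w => 1 - alpha w)).
  by apply: measurableT_comp => //; exact: measurable_powR.
by apply/funext => w /=; rewrite powR_inv1// subr_alpha_ge0.
Qed.

Let mmu : measurable_fun [set: T] mu.
Proof.
by apply: measurable_funM; first exact: measurable_cst.
Qed.

(** Satisfied by the functions of alpha; such weights can be used at every step
    of the recursion, down to the initial value. *)
Definition of_alpha (W : T -> R) := forall i, off i W.

Lemma of_alphaM (f g : T -> R) : of_alpha f -> of_alpha g ->
  of_alpha (fun w => f w * g w).
Proof. by move=> hf hg i; apply: measurable_funM; [exact: hf|exact: hg]. Qed.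

Lemma of_alphaD (f g : T -> R) : of_alpha f -> of_alpha g ->
  of_alpha (fun w => f w + g w).
Proof. by move=> hf hg i; apply: measurable_funD; [exact: hf|exact: hg]. Qed.

Lemma of_alphaB (f g : T -> R) : of_alpha f -> of_alpha g ->
  of_alpha (fun w => f w - g w).
Proof. by move=> hf hg i; apply: measurable_funB; [exact: hf|exact: hg]. Qed.

Lemma of_alpha_cst (c : R) : of_alpha (fun=> c).
Proof. by move=> i; exact: measurable_cst. Qed.

Lemma of_alpha_alpha : of_alpha alpha.
Proof. by move=> i; exact: measurable_off_Z. Qed.

(** The conditional mean [mu] is preserved by the recursion. *)
Lemma inar_moment1 k (W : T -> R) : of_alpha W -> (forall w, 0 <= W w) ->
  E (fun w => W w * (X k w)%:R) = E (fun w => W w * mu w).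
Proof.
have a0 := alpha_ge0.
elim: k W => [|k IH] W hW W0.
  by have [-> _] := init_weight (hW _) W0.
have mW : measurable_fun setT W by exact: (history_measurable (k := 0%N) (fun i _ => hW i)).
have mXk := @measurable_inar k.
have [-> _] := one_step_moments (k := k) (fun i _ => hW i) W0.
transitivity (E (fun w => W w * alpha w * (X k w)%:R + W w * lambda)).
  by apply: eq_mean => w; ring.
have hWa : of_alpha (fun w => W w * alpha w) by exact: of_alphaM hW of_alpha_alpha.
rewrite meanD; [|measurability|measurability|by move=> w; nonnegativity..].
rewrite IH//; last by move=> w; nonnegativity.
rewrite -meanD; [|measurability|measurability|by move=> w; nonnegativity..].
by apply: eq_mean => w; rewrite -[in RHS]mu_fix; ring.
Qed.

(** The conditional second moment [mu ^+ 2 + mu] is that of the Poisson law with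
    parameter [mu], which is stationary. *)
Lemma inar_moment2 k (W : T -> R) : of_alpha W -> (forall w, 0 <= W w) ->
  E (fun w => W w * (X k w)%:R ^+ 2) = E (fun w => W w * (mu w ^+ 2 + mu w)).
Proof.
have a0 := alpha_ge0; have b0 := subr_alpha_ge0.
elim: k W => [|k IH] W hW W0.
  by have [_ ->] := init_weight (hW _) W0.
have mW : measurable_fun setT W by exact: (history_measurable (k := 0%N) (fun i _ => hW i)).
have mXk := @measurable_inar k.
have [_ ->] := one_step_moments (k := k) (fun i _ => hW i) W0.
transitivity (E (fun w => W w * (alpha w * alpha w) * (X k w)%:R ^+ 2
    + (W w * (alpha w * (2 * lambda + (1 - alpha w))) * (X k w)%:R
       + W w * (lambda * lambda + lambda)))).
  by apply: eq_mean => w; ring.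
have ha := of_alpha_alpha.
have hWaa : of_alpha (fun w => W w * (alpha w * alpha w)).
  by apply: of_alphaM => //; exact: of_alphaM.
have hWb : of_alpha (fun w => W w * (alpha w * (2 * lambda + (1 - alpha w)))).
  apply: of_alphaM => //; apply: of_alphaM => //; apply: of_alphaD.
    exact: of_alpha_cst.
  by apply: of_alphaB => //; exact: of_alpha_cst.
rewrite meanD; [|measurability|measurability|by move=> w; nonnegativity..].
rewrite meanD; [|measurability|measurability|by move=> w; nonnegativity..].
rewrite IH//; last by move=> w; nonnegativity.
rewrite inar_moment1//; last by move=> w; nonnegativity.
rewrite -meanD; [|measurability|measurability|by move=> w; nonnegativity..].
rewrite -meanD; [|measurability|measurability|by move=> w; nonnegativity..].
apply: eq_mean => w; rewrite -!mulrA -!mulrDr; congr (_ * _).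
transitivity ((mu w * alpha w + lambda) ^+ 2 + (mu w * alpha w + lambda)); first ring.
by rewrite mu_fix.
Qed.

(** [A] and [B] are the increasing partial sums of the process and of its
    one-step conditional means; their difference is the martingale. *)
Let A N w : R := \sum_(1 <= k < N.+1) (X k w)%:R.
Let B N w : R := \sum_(0 <= k < N) ((X k w)%:R * alpha w + lambda).

Let AS N w : A N.+1 w = A N w + (X N.+1 w)%:R.
Proof. by rewrite /A big_nat_recr. Qed.

Let BS N w : B N.+1 w = B N w + ((X N w)%:R * alpha w + lambda).
Proof. by rewrite /B big_nat_recr. Qed.

Lemma inar_martingale N w :
  (1 - alpha w) * A N w
  = (A N w - B N w) + N%:R * lambda - alpha w * ((X N w)%:R - (X 0 w)%:R).
Proof.
elim: N => [|N IH].
  by rewrite /A /B !big_geq//; ring.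
have -> : (1 - alpha w) * A N.+1 w
    = (1 - alpha w) * A N w + (1 - alpha w) * (X N.+1 w)%:R.
  by rewrite AS; ring.
by rewrite IH AS BS -[in RHS]natr1; ring.
Qed.

(** The weight [(1 - alpha) ^+ 2] compensates [mu ^+ 2], of order
    [(1 - alpha) ^- 2], so that weighted second moments are finite even when
    those of the process are not. *)
Let W w : R := (1 - alpha w) * (1 - alpha w).

Let W0 w : 0 <= W w. Proof. by rewrite mulr_ge0// subr_alpha_ge0. Qed.

Let hW : of_alpha W.
Proof.
by apply: of_alphaM; apply: of_alphaB; solve [exact: of_alpha_cst|exact: of_alpha_alpha].
Qed.

Let mW : measurable_fun [set: T] W.
Proof. exact: measurable_funM. Qed.

Let weighted_square_finite (f : T -> R) := (E (fun w => W w * f w ^+ 2) < +oo)%E.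

Let weighted_square_finiteD (f g : T -> R) : measurable_fun setT f -> measurable_fun setT g ->
  weighted_square_finite f -> weighted_square_finite g ->
  weighted_square_finite (fun w => f w + g w).
Proof.
move=> mf mg ff fg; rewrite /weighted_square_finite.
apply: (@le_lt_trans _ _ (E (fun w => W w * f w ^+ 2 + W w * f w ^+ 2
    + (W w * g w ^+ 2 + W w * g w ^+ 2)))).
  apply: le_mean; [measurability|measurability| |].
    by move=> w; rewrite mulr_ge0// sqr_ge0.
  move=> w; rewrite -!mulrDr ler_wpM2l//.
  by have := sqr_ge0 (f w - g w); nra.
have W20 h w : 0 <= W w * h w ^+ 2 by rewrite mulr_ge0// sqr_ge0.
rewrite !meanD.
  by apply: lte_add_pinfty; apply: lte_add_pinfty; solve [exact: ff|exact: fg].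
all: by [measurability|move=> w; rewrite ?addr_ge0].
Qed.

Let weighted_square_finiteX k : weighted_square_finite (fun w => (X k w)%:R).
Proof.
rewrite /weighted_square_finite inar_moment2//.
apply: (@le_lt_trans _ _ (E (fun=> lambda ^+ 2 + lambda))).
  apply: le_mean; [measurability|measurability|by move=> w; nonnegativity|] => w.
  have b1 : 1 - alpha w <= 1 by rewrite gerBl alpha_ge0.
  have e : (1 - alpha w) * mu w = lambda.
    by rewrite /mu mulrC divfK// gt_eqF// subr_alpha_gt0.
  have -> : W w * (mu w ^+ 2 + mu w) = ((1 - alpha w) * mu w) ^+ 2
      + (1 - alpha w) * ((1 - alpha w) * mu w) by rewrite /W; ring.
  by rewrite e lerD2l ler_piMl.
by rewrite mean_cst ltry.
Qed.

Let m N w : R := (X N w)%:R * alpha w + lambda.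

Let m_ge0 N w : 0 <= m N w.
Proof. by rewrite /m addr_ge0// mulr_ge0// alpha_ge0. Qed.

Let history_m N : history N (m N).
Proof.
apply: historyD; last exact: history_cst.
apply: historyM; last exact: history_alpha.
exact: (history_natr (fun n => n%:R) (@history_inar N)).
Qed.

Let weighted_square_finite_m N : weighted_square_finite (m N).
Proof.
have mX := @measurable_inar N.
apply: weighted_square_finiteD; [measurability|measurability| |].
  apply: le_lt_trans (weighted_square_finiteX N).
  apply: le_mean; [measurability|measurability| |].
    by move=> w; rewrite mulr_ge0// sqr_ge0.
  move=> w; rewrite ler_wpM2l// exprMn ler_piMr ?sqr_ge0//.
  by rewrite expr_le1 ?alpha_ge0//; have /andP[_ /ltW] := alpha01 w.
apply: (@le_lt_trans _ _ (E (fun=> lambda ^+ 2))).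
  apply: le_mean; [measurability|measurability|by move=> w; nonnegativity|] => w.
  rewrite ler_piMl ?sqr_ge0// /W mulr_ile1 ?subr_alpha_ge0//;
    by rewrite gerBl alpha_ge0.
by rewrite mean_cst ltry.
Qed.

Let A_ge0 N w : 0 <= A N w. Proof. by apply: sumr_ge0. Qed.

Let B_ge0 N w : 0 <= B N w. Proof. by apply: sumr_ge0 => k _; exact: m_ge0. Qed.

Let history_A N : history N (A N).
Proof.
elim: N => [|N IH].
  have -> : A 0 = fun=> 0 by apply/funext => w; rewrite /A big_geq.
  exact: history_cst.
have -> : A N.+1 = fun w => A N w + (X N.+1 w)%:R by apply/funext => w; rewrite AS.
apply: historyD; first exact: history_le IH.
exact: (history_natr (fun n => n%:R) (@history_inar N.+1)).
Qed.

Let history_B N : history N (B N.+1).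
Proof.
elim: N => [|N IH].
  have -> : B 1 = m 0 by apply/funext => w; rewrite /B big_nat1.
  exact: history_m.
have -> : B N.+2 = fun w => B N.+1 w + m N.+1 w by apply/funext => w; rewrite BS.
apply: historyD; first exact: history_le IH.
exact: history_m.
Qed.

Let measurable_A N : measurable_fun setT (A N).
Proof. exact: (history_measurable (@history_A N)). Qed.

Let measurable_B N : measurable_fun setT (B N).
Proof.
case: N => [|N]; last exact: (history_measurable (@history_B N)).
have -> : B 0 = fun=> 0 by apply/funext => w; rewrite /B big_geq.
exact: measurable_cst.
Qed.

Let weighted_square_finite_A N : weighted_square_finite (A N).
Proof.
elim: N => [|N IH].
  rewrite /weighted_square_finite (eq_mean P (g := fun=> 0)).
    by rewrite /mean integral0.
  by move=> w; rewrite /A big_geq// expr0n mulr0.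
have -> : A N.+1 = fun w => A N w + (X N.+1 w)%:R by apply/funext => w; rewrite AS.
apply: weighted_square_finiteD => //.
exact: measurable_natR (@measurable_inar _).
Qed.

Let weighted_square_finite_B N : weighted_square_finite (B N).
Proof.
elim: N => [|N IH].
  rewrite /weighted_square_finite (eq_mean P (g := fun=> 0)).
    by rewrite /mean integral0.
  by move=> w; rewrite /B big_geq// expr0n mulr0.
have -> : B N.+1 = fun w => B N w + m N w by apply/funext => w; rewrite BS.
apply: weighted_square_finiteD => //.
exact: (history_measurable (@history_m N)).
Qed.

(** Orthogonality of the increment to the past.  To stay with integrals of
    nonnegative functions, the negative cross terms of both squares are added
    to both sides; this common quantity is finite and can be cancelled. *)
Lemma martingale_increment_variance N :
  E (fun w => W w * (A N.+1 w - B N.+1 w) ^+ 2)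
  = (E (fun w => W w * (A N w - B N w) ^+ 2)
     + E (fun w => W w * ((X N w)%:R * (alpha w * (1 - alpha w)) + lambda)))%E.
Proof.
have a0 := alpha_ge0; have b0 := subr_alpha_ge0.
have mm := history_measurable (@history_m N).
have mX := @measurable_inar N.
have mX' := @measurable_inar N.+1.
have mA := @measurable_A N; have mA' := @measurable_A N.+1.
have mB := @measurable_B N; have mB' := @measurable_B N.+1.
have A0 := A_ge0 N; have A0' := A_ge0 N.+1; have B0 := B_ge0 N; have B0' := B_ge0 N.+1.
have m0 := m_ge0 N.
have mAB : measurable_fun [set: T] (fun w => A N w - B N w) by exact: measurable_funB.
have mAB' : measurable_fun [set: T] (fun w => A N.+1 w - B N.+1 w).
  exact: measurable_funB.
have hWN : history N W by move=> i _; exact: hW.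
have hWA : history N (fun w => W w * (2 * A N w)).
  by apply: historyM => //; apply: historyM => //; exact: history_cst.
have hWB : history N (fun w => W w * (2 * B N.+1 w)).
  by apply: historyM => //; apply: historyM => //; exact: history_cst.
have WA0 w : 0 <= W w * (2 * A N w) by nonnegativity.
have WB0 w : 0 <= W w * (2 * B N.+1 w) by nonnegativity.
have [_ X2] := one_step_moments hWN W0.
have [XA _] := one_step_moments hWA WA0.
have [XB _] := one_step_moments hWB WB0.
(* the cross terms, with the last step of the process replaced by its mean *)
pose c w := W w * (2 * A N w) * B N.+1 w + W w * (2 * B N.+1 w) * m N w.
have mc : measurable_fun [set: T] c by rewrite /c; measurability.
have c0 w : 0 <= c w by rewrite /c; nonnegativity.
have c_fin : E c \is a fin_num.
{ rewrite ge0_fin_numE ?mean_ge0//.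
  apply: (@le_lt_trans _ _ (E (fun w => W w * A N w ^+ 2 + W w * B N.+1 w ^+ 2
      + (W w * B N.+1 w ^+ 2 + W w * m N w ^+ 2)))).
    apply: le_mean; [by []|measurability|by []|] => w.
    have -> : c w = W w * (2 * A N w * B N.+1 w + 2 * B N.+1 w * m N w).
      by rewrite /c; ring.
    rewrite -!mulrDr ler_wpM2l//.
    by have := sqr_ge0 (A N w - B N.+1 w); have := sqr_ge0 (B N.+1 w - m N w); nra.
  have W20 h w : 0 <= W w * h w ^+ 2 by rewrite mulr_ge0// sqr_ge0.
  rewrite !meanD.
    by apply: lte_add_pinfty; apply: lte_add_pinfty; solve
    [exact: weighted_square_finite_A|exact: weighted_square_finite_B
    |exact: weighted_square_finite_m].
  all: try by move=> w; do ?[exact: W20|apply: addr_ge0].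
  all: by measurability. }
apply: (adde_cancel c_fin).
have split_c : E c = (E (fun w => W w * (2 * A N w) * B N.+1 w)
    + E (fun w => W w * (2 * B N.+1 w) * (X N.+1 w)%:R))%E.
  by rewrite XB /c meanD; [|measurability|measurability|by move=> w; nonnegativity..].
transitivity (E (fun w => W w * (A N w ^+ 2 + B N.+1 w ^+ 2)
   + (W w * (2 * A N w) * (X N.+1 w)%:R + W w * (X N.+1 w)%:R ^+ 2))).
  rewrite split_c -meanD; [|measurability|measurability|by move=> w; nonnegativity..].
  rewrite -meanD; [|measurability|measurability| |by move=> w; nonnegativity].
    by apply: eq_mean => w; rewrite AS; ring.
  by move=> w; rewrite mulr_ge0// sqr_ge0.
rewrite meanD; [|measurability|measurability|by move=> w; nonnegativity..].
rewrite meanD; [|measurability|measurability|by move=> w; nonnegativity..].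
rewrite XA X2.
have AB2 w : 0 <= W w * (A N w - B N w) ^+ 2 by rewrite mulr_ge0// sqr_ge0.
rewrite -meanD; [|measurability|measurability|by move=> w; nonnegativity..].
rewrite -meanD; [|measurability|measurability|by move=> w; nonnegativity..].
rewrite -meanD; [|measurability|measurability|by []|by move=> w; nonnegativity].
rewrite -meanD; [|measurability|measurability| |by []]; last first.
  by move=> w; rewrite addr_ge0//; nonnegativity.
by apply: eq_mean => w; rewrite /c BS /m; ring.
Qed.

(** With the weight, an increment contributes at most 2 lambda, because
    [(1 - alpha) * mu = lambda]. *)
Lemma martingale_variance N :
  (E (fun w => W w * (A N w - B N w) ^+ 2) <= (2 * lambda * N%:R)%:E)%E.
Proof.
elim: N => [|N IH].
  rewrite (eq_mean P (g := fun=> 0)); first by rewrite /mean integral0 mulr0.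
  by move=> w; rewrite /A /B !big_geq// subr0 expr0n mulr0.
have a0 := alpha_ge0; have b0 := subr_alpha_ge0.
have mX := @measurable_inar N.
rewrite martingale_increment_variance -(natr1 N) mulrDr mulr1 EFinD leeD//.
have hWb : of_alpha (fun w => W w * (alpha w * (1 - alpha w))).
  have hb : of_alpha (fun w => 1 - alpha w).
    by apply: of_alphaB; [exact: of_alpha_cst|exact: of_alpha_alpha].
  by apply: of_alphaM => //; apply: of_alphaM => //; exact: of_alpha_alpha.
rewrite (eq_mean P (g := fun w =>
  W w * (alpha w * (1 - alpha w)) * (X N w)%:R + W w * lambda)); last first.
  by move=> w; ring.
rewrite meanD; [|measurability|measurability|by move=> w; nonnegativity..].
rewrite inar_moment1//; last by move=> w; nonnegativity.
rewrite -meanD; [|measurability|measurability|by move=> w; nonnegativity..].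
apply: (@le_trans _ _ (E (fun=> 2 * lambda))).
  apply: le_mean; [measurability|measurability|by move=> w; nonnegativity|] => w.
  have e : (1 - alpha w) * mu w = lambda.
    by rewrite /mu mulrC divfK// gt_eqF// subr_alpha_gt0.
  rewrite -mulrA -(mulrA (alpha w)) e.
  have W1 : W w <= 1.
    by rewrite /W mulr_ile1 ?subr_alpha_ge0// gerBl alpha_ge0.
  have a1 : alpha w <= 1 by have /andP[_ /ltW] := alpha01 w.
  rewrite mulr2n mulrDl mul1r lerD// ?ler_piMl//.
  by rewrite mulrA ler_piMl// mulr_ile1.
by rewrite mean_cst.
Qed.

(** * The strong law of large numbers *)

Lemma inar_mean k : E (fun w => (X k w)%:R) = E mu.
Proof.
have := @inar_moment1 k (fun=> 1) (@of_alpha_cst 1) (fun=> ler01).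
by under eq_mean do rewrite mul1r; under [X in _ = X -> _]eq_mean do rewrite mul1r.
Qed.

Hypothesis alpha_int : (E (fun w => (1 - alpha w)^-1) < +oo)%E.

Lemma stationary_mean_fin_num : E mu \is a fin_num.
Proof.
have i0 w : 0 <= (1 - alpha w)^-1 by rewrite invr_ge0 subr_alpha_ge0.
by rewrite ge0_fin_numE ?mean_ge0// meanZ// lte_mul_pinfty// mean_ge0.
Qed.

(** Along the squares [s], the bounds [2 lambda s / s ^+ 2] for the martingale and
    [E mu / s] for the process are summable. *)
Lemma inar_squares_cvg : {ae P, forall w,
  A (k.+1 ^ 2) w / (k.+1 ^ 2)%:R @[k --> \oo] --> mu w}.
Proof.
pose c := fine (E mu); have cE : E mu = c%:E by rewrite fineK// stationary_mean_fin_num.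
have c0 : 0 <= c by rewrite fine_ge0// mean_ge0.
pose s k : R := (k.+1 ^ 2)%:R.
have s0 k : 0 < s k by rewrite ltr0n expn_gt0.
pose D k w := W w * (A (k.+1 ^ 2) w - B (k.+1 ^ 2) w) ^+ 2.
have mAB k : measurable_fun [set: T] (fun w => A (k.+1 ^ 2) w - B (k.+1 ^ 2) w).
  by apply: measurable_funB; [exact: measurable_A|exact: measurable_B].
have mD k : measurable_fun [set: T] (D k).
  have := mAB k; rewrite /D => ?; measurability.
have D0 k w : 0 <= D k w by rewrite mulr_ge0 ?sqr_ge0.
have mX k := @measurable_inar k.
pose f k w := (s k ^+ 2)^-1 * D k w + (s k)^-1 * (X (k.+1 ^ 2) w)%:R.
have i1 k : 0 <= (s k ^+ 2)^-1 by rewrite invr_ge0 exprn_ge0// ltW.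
have i2 k : 0 <= (s k)^-1 by rewrite invr_ge0 ltW.
have mf k : measurable_fun [set: T] (f k).
  by have := mX (k.+1 ^ 2)%N; rewrite /f => ?; measurability.
have f0 k w : 0 <= f k w by rewrite addr_ge0// mulr_ge0.
have : (\sum_(k <oo) \int[P]_w (f k w)%:E < +oo)%E.
  apply: le_lt_trans (@sum_inv_square_lt_pinfty R (2 * lambda + c) _); last first.
    by rewrite addr_ge0// mulr_ge0.
  apply: lee_nneseries => [k _ _|k _].
    by apply: integral_ge0 => w _; rewrite lee_fin.
  rewrite -/(mean P (f k)) meanD; [|measurability|measurability|by move=> w; rewrite mulr_ge0..].
  rewrite meanZ// meanZ//; last exact: measurable_natR.
  rewrite inar_mean cE mulrDl EFinD leeD//; last by rewrite -EFinM lee_fin mulrC.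
  apply: le_trans (lee_wpmul2l _ (martingale_variance _)) _; first by rewrite lee_fin.
  rewrite -EFinM lee_fin -/(s k) le_eqVlt; apply/orP; left; apply/eqP.
  by field; rewrite gt_eqF.
move=> /(ae_cvg0_of_summable_integral mf f0); apply: filterS => w fw.
have Dw : (s k ^+ 2)^-1 * D k w @[k --> \oo] --> (0 : R).
  apply: (squeeze_cvgr _ (cvg_cst 0) fw); near=> k.
  by rewrite mulr_ge0//= lerDl mulr_ge0.
have Xw : (s k)^-1 * (X (k.+1 ^ 2) w)%:R @[k --> \oo] --> (0 : R).
  apply: (squeeze_cvgr _ (cvg_cst 0) fw); near=> k.
  by rewrite mulr_ge0//= lerDr mulr_ge0.
have b := subr_alpha_gt0 w.
have sV : (s k)^-1 @[k --> \oo] --> (0 : R).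
  apply: (squeeze_cvgr _ (cvg_cst 0) (@cvg_harmonic R)); near=> k.
  rewrite i2/= lef_pV2// ?posrE// ler_nat expnS leq_pmulr// expn_gt0//.
have Mw : (A (k.+1 ^ 2) w - B (k.+1 ^ 2) w) / s k @[k --> \oo] --> (0 : R).
  apply: cvg0_of_sqr.
  have -> : (fun k => ((A (k.+1 ^ 2) w - B (k.+1 ^ 2) w) / s k) ^+ 2)
      = (fun k => (W w)^-1 * ((s k ^+ 2)^-1 * D k w)).
    apply/funext => k; rewrite /D expr_div_n mulrCA mulKf 1?[RHS]mulrC//.
    by rewrite /W mulf_neq0// gt_eqF.
  rewrite -[X in _ --> X](mulr0 (W w)^-1).
  by apply: cvgM => //; exact: cvg_cst.
have -> : mu w = (0 + lambda - alpha w * (0 - (X 0 w)%:R * 0)) * (1 - alpha w)^-1.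
  by rewrite mulr0 subrr mulr0 subr0 add0r.
pose g k := ((A (k.+1 ^ 2) w - B (k.+1 ^ 2) w) / s k + lambda
  - alpha w * ((s k)^-1 * (X (k.+1 ^ 2) w)%:R - (X 0 w)%:R * (s k)^-1))
  * (1 - alpha w)^-1.
have -> : (fun k => A (k.+1 ^ 2) w / (k.+1 ^ 2)%:R) = g.
  apply/funext => k; rewrite /g -/(s k); apply: (mulfI (lt0r_neq0 b)).
  rewrite mulrA inar_martingale -/(s k).
  by field; rewrite !gt_eqF.
apply: cvgM; last exact: cvg_cst.
apply: cvgB; first by apply: cvgD => //; exact: cvg_cst.
apply: cvgM; first exact: cvg_cst.
apply: cvgB => //.
by apply: cvgM => //; exact: cvg_cst.
Unshelve. all: by end_near. Qed.

(** Partial sums are nondecreasing, so convergence along squares is enough. *)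
Lemma inar_strong_law : {ae P, forall w,
  A n w / n%:R @[n --> \oo] --> mu w}.
Proof.
move: inar_squares_cvg; apply: filterS => w; apply: cvg_mean_of_squares.
  by move=> n; exact: A_ge0.
have ndA : nondecreasing_seq (A^~ w).
  by apply/nondecreasing_seqP => n; rewrite AS lerDl.
by move=> i n /ndA.
Qed.

(** Almost sure convergence of the vectors of scaled sums and domination by a
    bound of [f]. *)
Lemma inar_scaled_sums_cvg_in_law p (t : 'I_p -> R) (c : R) (f : 'rV[R]_p -> R) :
  (forall a, 0 <= t a) -> continuous f -> [bounded f x | x in [set: 'rV[R]_p]] ->
  (\int[P]_w (f (scaled_sums t c n (X^~ w)))%:E @[n --> \oo]
   --> \int[P]_w (f (\row_a ((mu w - c) * t a)))%:E)%E.
Proof.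
move=> t0 cf bf.
have PF : ProperFilter (globally [set: 'rV[R]_p]).
  exact: (globally_properfilter (a := 0)).
have [M fM] := (ex_bound f).1 bf.
have {}fM x : `|f x| <= M by exact: fM.
have mfn n : measurable_fun [set: T] (fun w => (f (scaled_sums t c n (X^~ w)))%:E).
  by apply/measurable_EFinP; apply: measurable_fun_scaled_sums measurable_inar.
have mflim : measurable_fun [set: T] (fun w => (f (\row_a ((mu w - c) * t a)))%:E).
  apply/measurable_EFinP; apply: measurable_fun_line => //.
  by apply: measurable_funB.
have iM : P.-integrable [set: T] (fun=> M%:E).
  exact: finite_measure_integrable_cst.
have cv : {ae P, forall w, [set: T] w ->
    (f (scaled_sums t c n (X^~ w)))%:E @[n --> \oo]
    --> (f (\row_a ((mu w - c) * t a)))%:E}.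
  move: inar_strong_law; apply: filterS => w Aw _.
  apply: cvg_EFin; first by apply: nearW.
  apply: (@cvg_comp _ _ _ (fun n => scaled_sums t c n (X^~ w)) f); last exact: cf.
  exact: scaled_sums_cvg.
have dom : {ae P, forall w n, [set: T] w ->
    (`|(f (scaled_sums t c n (X^~ w)))%:E| <= M%:E)%E}.
  by apply: aeW => w n _; rewrite lee_fin.
by have [_ _] := dominated_convergence measurableT mfn mflim cv iM dom.
Qed.

End randomized_inar.

(** * Convergence of the finite-dimensional distributions *)

Theorem proposition4p4 (R : realType)
    (d : measure_display) (T : measurableType d) (P : probability T R)
    (lambda : R) (lambda_gt0 : 0 < lambda)
    (alpha : {RV P >-> R}) (alpha01 : forall w, 0 < alpha w < 1)
    (X0 : {RV P >-> nat}) (xi : nat -> nat -> {RV P >-> nat})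
    (eps : nat -> {RV P >-> nat})
    (indep : cond_independent P alpha (inar_family X0 xi eps))
    (xi_law : forall k j, (1 <= k)%N -> (1 <= j)%N ->
       is_cond_prob P alpha (xi k j @^-1` [set 1%N]) alpha /\
       is_cond_prob P alpha (xi k j @^-1` [set 0%N]) (fun w => 1 - alpha w))
    (eps_law : forall k, (1 <= k)%N -> forall l : nat,
       is_cond_prob P alpha (eps k @^-1` [set l])
         (fun=> poisson_pmf lambda l))
    (X0_law : forall l : nat,
       is_cond_prob P alpha (X0 @^-1` [set l])
         (fun w => poisson_pmf (lambda / (1 - alpha w)) l))
    (d1 : measure_display) (T1 : measurableType d1) (P1 : probability T1 R)
    (X1 : nat -> {RV P1 >-> nat})
    (X1_copy : same_fdd P1 X1 P (inar1 X0 xi eps))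
    (alpha_int : ('E_P[fun w => ((1 - alpha w)^-1)%R] < +oo)%E) :
  cvg_fdd P1 P
    (fun (n : nat) (t : R) (w : T1) =>
       n%:R^-1 * \sum_(1 <= k < (Num.truncn (n%:R * t)).+1) centered P1 X1 k w)
    (fun (t : R) (w : T) =>
       (lambda / (1 - alpha w)
        - fine 'E_P[fun w' => (lambda / (1 - alpha w'))%R]%E) * t).
Proof.
have mX k : measurable_fun [set: T] (inar1 X0 xi eps k).
  exact: (measurable_inar alpha).
(* all the means of the copy equal this constant *)
pose c := fine (\int[P]_w (lambda / (1 - alpha w))%:E)%E.
have mX1 k : measurable_fun [set: T1] (X1 k) by exact: measurable_funP.
have mean_X1 k : fine 'E_P1[fun w => (X1 k w)%:R%R]%E = c.
  rewrite unlock /c; congr fine.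
  have := same_fdd_integral (m := 1) (fun=> k) (fun v => (v ord0)%:R) mX1 mX X1_copy.
  move=> /= ->.
  exact: (inar_mean lambda_gt0 alpha01 indep xi_law eps_law X0_law).
have int_lt : (mean P (fun w => (1 - alpha w)^-1%R)%R < +oo)%E.
  by move: alpha_int; rewrite unlock.
move=> m t t0 f cf bf.
have cvg_P := inar_scaled_sums_cvg_in_law lambda_gt0 alpha01 indep xi_law eps_law
  X0_law int_lt (c := c) t0 cf bf.
pose Y n w : 'rV[R]_m := \row_a (n%:R^-1
  * \sum_(1 <= k < (Num.truncn (n%:R * t a)).+1) centered P1 X1 k w).
have Y_int n : (\int[P1]_w (f (Y n w))%:E
    = \int[P]_w (f (scaled_sums t c n (fun k => inar1 X0 xi eps k w)))%:E)%E.
  rewrite -(same_fdd_scaled_sums t c n f mX1 mX X1_copy).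
  apply: eq_integral => w _; congr (f _)%:E; apply/rowP => a; rewrite !mxE.
  congr (_ * _); apply: eq_bigr => k _.
  by rewrite /centered mean_X1.
by rewrite unlock; move: cvg_P; rewrite -(funext Y_int); apply.
Qed.
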